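(* Let $n\ge 1$ be an integer. Assume that $s_0>0$ and that $\mathcal{L}\in C^0([0,\infty))\cap C^1((0,s_0))$ is positive on $(0,\infty)$, bounded, nondecreasing, and such that there exist $a,\lambda_0>0$ with $$\mathcal{L}(s)\le (1+a\lambda)\,\mathcal{L}(s^{1+\lambda})\qquad\text{for all } s\in(0,s_0)\text{ and }\lambda\in(0,\lambda_0).$$ Then for any $K>0$ and any $q>0$ with $q<\frac{2n}{(n-2)_+}$ there exists $C=C(n,q,K)>0$ such that if $0\not\equiv\varphi\in W^{1,2}(\mathbb{R}^n)$ is a nonnegative function satisfying $$\int_{\mathbb{R}^n}\mathcal{L}(\varphi)\,dx\le K,$$ then $$\|\varphi\|_{L^q(\mathbb{R}^n)}\le C\,\|\nabla\varphi\|_{L^2(\mathbb{R}^n)}\,\Big[\mathcal{L}\Big(\|\nabla\varphi\|_{L^2(\mathbb{R}^n)}^2\Big)\Big]^{-\left(\frac1q-\frac{n-2}{2n}\right)}.$$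
   Context: The function $\mathcal{L}$ is fixed first, so the constant $C$ may depend on $\mathcal{L}$ in addition to $n,q,K$, but not on $\varphi$. For $q>0$ (including $q<1$), $\|\varphi\|_{L^q(\mathbb{R}^n)}:=(\int_{\mathbb{R}^n}|\varphi|^q)^{1/q}$. Here $(n-2)_+=\max\{n-2,0\}$ and $\frac{2n}{(n-2)_+}:=\infty$ if $n\le 2$. *)

(* Defs.v *)
From HB Require Import structures.
From mathcomp Require Import all_boot all_order all_algebra.
From mathcomp Require Import all_classical all_reals all_analysis.

Set Implicit Arguments.
Unset Strict Implicit.
Unset Printing Implicit Defensive.

Import Order.TTheory GRing.Theory Num.Theory.
Import numFieldNormedType.Exports.

Local Open Scope classical_set_scope.
Local Open Scope ring_scope.

(** R^n is ['rV[R]_n], with the sigma-algebra generated by the coordinates, as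
    the library does for [n.-tuple T]; this is the Borel sigma-algebra. *)

Definition rV_display : measure_display.
Proof. exact: default_measure_display. Qed.

Section measurable_rV.
Context (R : realType) (n : nat).

Let coord (i : 'I_n) (x : 'rV[R]_n) : R := x ord0 i.

Let rV_set0 : g_sigma_preimage coord set0.
Proof. exact: sigma_algebra0. Qed.

Let rV_setC A : g_sigma_preimage coord A -> g_sigma_preimage coord (~` A).
Proof. exact: sigma_algebraC. Qed.

Let rV_bigcup (F : (set 'rV[R]_n)^nat) :
  (forall i, g_sigma_preimage coord (F i)) ->
  g_sigma_preimage coord (\bigcup_i (F i)).
Proof. exact: sigma_algebra_bigcup. Qed.

HB.instance Definition _ := @isMeasurable.Build rV_display 'rV[R]_n
  (g_sigma_preimage coord) rV_set0 rV_setC rV_bigcup.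

Lemma measurable_rV_coord (i : 'I_n) :
  measurable_fun setT (fun x : 'rV[R]_n => x ord0 i).
Proof.
move=> _ Y mY; rewrite setTI; apply: sub_sigma_algebra => /=.
rewrite -bigcup_seq/=; exists i => /=; first by rewrite mem_index_enum.
by exists Y => //; rewrite setTI.
Qed.

Lemma measurable_fun_rV d (T : measurableType d) (f : T -> 'rV[R]_n) :
  (forall i, measurable_fun setT (fun x => f x ord0 i)) ->
  measurable_fun setT f.
Proof.
move=> mf _ A; rewrite setTI; move: A.
suff : (@measurable _ 'rV[R]_n) `<=` [set A | measurable (f @^-1` A)] by [].
apply: smallest_sub.
- split; rewrite /=.
  + by rewrite preimage_set0.
  + by move=> A mA; rewrite setTD preimage_setC; exact: measurableC.
  + by move=> F mF; rewrite preimage_bigcup; exact: bigcupT_measurable.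
- rewrite -bigcup_seq; apply: bigcup_sub => i _ _ [B mB <-] /=.
  by rewrite setTI; have := mf i measurableT _ mB; rewrite setTI.
Qed.

End measurable_rV.

Definition rV_cons (R : realType) (n : nat) (p : measurableTypeR R * 'rV[R]_n) :
  'rV[R]_n.+1 := \row_i oapp (p.2 ord0) p.1 (unlift ord0 i).

Lemma rV_cons_ord0 (R : realType) n (p : measurableTypeR R * 'rV[R]_n) :
  rV_cons p ord0 ord0 = p.1.
Proof. by rewrite mxE unlift_none. Qed.

Lemma rV_cons_lift (R : realType) n (p : measurableTypeR R * 'rV[R]_n) i :
  rV_cons p ord0 (lift ord0 i) = p.2 ord0 i.
Proof. by rewrite mxE liftK. Qed.

Lemma measurable_rV_cons (R : realType) n :
  measurable_fun setT (@rV_cons R n).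
Proof.
apply: measurable_fun_rV => i; case: (unliftP ord0 i) => [j ->|->].
  under eq_fun do rewrite rV_cons_lift.
  exact: (measurableT_comp (measurable_rV_coord j) measurable_snd).
under eq_fun do rewrite rV_cons_ord0.
exact: measurable_fst.
Qed.

Definition rV_uncons (R : realType) (n : nat) (x : 'rV[R]_n.+1) :
  measurableTypeR R * 'rV[R]_n := (x ord0 ord0, \row_i x ord0 (lift ord0 i)).

Lemma rV_consK (R : realType) n : cancel (@rV_cons R n) (@rV_uncons R n).
Proof.
move=> [a v]; rewrite /rV_uncons rV_cons_ord0; congr (_, _).
by apply/rowP => i; rewrite mxE rV_cons_lift.
Qed.

Lemma rV_unconsK (R : realType) n : cancel (@rV_uncons R n) (@rV_cons R n).
Proof.
move=> x; apply/rowP => i; case: (unliftP ord0 i) => [j ->|->].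
  by rewrite rV_cons_lift mxE.
by rewrite rV_cons_ord0.
Qed.

Lemma measurable_rV_uncons (R : realType) n :
  measurable_fun setT (@rV_uncons R n).
Proof.
apply/measurable_fun_pairP; split; first exact: measurable_rV_coord.
apply: measurable_fun_rV => i /=.
under eq_fun do rewrite mxE.
exact: measurable_rV_coord.
Qed.

Section lebesgue_rV.
Context (R : realType).
Local Open Scope ereal_scope.

Section step.
Context (n : nat) (mu : {sigma_finite_measure set 'rV[R]_n -> \bar R}).

Definition lebesgue_rV_step : set 'rV[R]_n.+1 -> \bar R :=
  pushforward (@lebesgue_measure R \x mu) (@rV_cons R n).

Let step0 : lebesgue_rV_step set0 = 0.
Proof. by rewrite /lebesgue_rV_step /pushforward preimage_set0 measure0. Qed.

Let step_ge0 A : 0 <= lebesgue_rV_step A.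
Proof. exact: (measure_ge0 (@lebesgue_measure R \x mu)%E). Qed.

Let step_sigma_additive : semi_sigma_additive lebesgue_rV_step.
Proof.
have mcons A : measurable A -> measurable (@rV_cons R n @^-1` A).
  by move=> mA; rewrite -[X in measurable X]setTI; exact: measurable_rV_cons.
move=> F mF tF mUF; rewrite /lebesgue_rV_step /pushforward preimage_bigcup.
apply: (@measure_semi_sigma_additive _ _ _ (@lebesgue_measure R \x mu)%E).
- by move=> k; exact: mcons.
- apply/trivIsetP => i j _ _ ij; rewrite -preimage_setI.
  by move/trivIsetP : tF => /(_ _ _ I I ij) ->; rewrite preimage_set0.
- by rewrite -preimage_bigcup; exact: mcons.
Qed.

HB.instance Definition _ := isMeasure.Build _ _ _ lebesgue_rV_step
  step0 step_ge0 step_sigma_additive.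

Let step_sigma_finite : sigma_finite setT lebesgue_rV_step.
Proof.
have /sigma_finiteP[F [TF ndF Foo]] := sigma_finiteT (@lebesgue_measure R).
have /sigma_finiteP[G [TG ndG Goo]] := sigma_finiteT mu.
exists (fun k => @rV_uncons R n @^-1` (F k `*` G k)).
  apply/esym; rewrite -subTset => x _.
  have : (\bigcup_k F k) (rV_uncons x).1 by rewrite -TF.
  have : (\bigcup_k G k) (rV_uncons x).2 by rewrite -TG.
  move=> [j _ Gj] [i _ Fi]; exists (maxn i j) => //; split.
  - by move: Fi; exact/subsetPset/ndF/leq_maxl.
  - by move: Gj; exact/subsetPset/ndG/leq_maxr.
move=> k; have [mF Fk] := Foo k; have [mG Gk] := Goo k; split.
  rewrite -[X in measurable X]setTI; apply: measurable_rV_uncons => //.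
  exact: measurableX.
rewrite /lebesgue_rV_step /pushforward -comp_preimage.
rewrite (_ : _ \o _ = id); last by apply/funext => p /=; rewrite rV_consK.
by rewrite preimage_id product_measure1E// lte_mul_pinfty// ge0_fin_numE.
Qed.

HB.instance Definition _ := Measure_isSigmaFinite.Build _ _ _ lebesgue_rV_step
  step_sigma_finite.

End step.

(** R^0 is a point, of mass 1; R^(n+1) is identified with R x R^n.  The value
    on boxes, in [lebesgue_rV_box] below, characterizes this measure. *)
Fixpoint lebesgue_rV (n : nat) : {sigma_finite_measure set 'rV[R]_n -> \bar R} :=
  match n with
  | 0 => \d_(0%R : 'rV[R]_0)
  | m.+1 => lebesgue_rV_step (lebesgue_rV m)
  end.

Lemma measurable_box n (A : 'I_n -> set R) : (forall i, measurable (A i)) ->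
  measurable [set x : 'rV[R]_n | forall i, A i (x ord0 i)].
Proof.
move=> mA; rewrite (_ : [set _ | _] =
    \bigcap_(i in [set: 'I_n]) ((fun x : 'rV[R]_n => x ord0 i) @^-1` A i)).
  apply: fin_bigcap_measurable => //= i _.
  by rewrite -[X in measurable X]setTI; exact: measurable_rV_coord.
by apply/seteqP; split=> x /= Ax i => [_|]; exact: Ax.
Qed.

Lemma lebesgue_rV_box n (A : 'I_n -> set R) : (forall i, measurable (A i)) ->
  lebesgue_rV n [set x | forall i, A i (x ord0 i)] =
  \prod_(i < n) lebesgue_measure (A i).
Proof.
elim: n A => [|n IHn] A mA.
  rewrite big_ord0 /= diracE mem_set//= => -[]//.
rewrite big_ord_recl /= /lebesgue_rV_step /pushforward.
rewrite (_ : _ @^-1` _ = A ord0 `*`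
    [set y : 'rV[R]_n | forall i, A (lift ord0 i) (y ord0 i)]).
  have mA' i : measurable (A (lift ord0 i)) by exact: mA.
  rewrite product_measure1E ?(IHn _ mA')//; first exact: mA.
  exact: (@measurable_box n (fun i => A (lift ord0 i)) mA').
apply/seteqP; split=> [p /= Ap|p /= [A0 Ap] i].
  by split=> [|i]; [have := Ap ord0|have := Ap (lift ord0 i)];
    rewrite ?rV_cons_ord0 ?rV_cons_lift.
by case: (unliftP ord0 i) => [j ->|->]; rewrite ?rV_cons_ord0 ?rV_cons_lift.
Qed.

End lebesgue_rV.

Section sobolev.
Context (R : realType) (n : nat).
Implicit Types (f g psi : 'rV[R]_n -> R) (G : 'rV[R]_n -> 'rV[R]_n).

Local Notation mu := (@lebesgue_rV R n).
Local Notation e_ i := (delta_mx ord0 i : 'rV[R]_n).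

Fixpoint Ck (k : nat) f : Prop :=
  if k is k'.+1 then
    continuous f /\
    forall i : 'I_n, (forall x, derivable f x (e_ i)) /\ Ck k' ('D_(e_ i) f)
  else continuous f.

Definition test_function psi : Prop :=
  (forall k, Ck k psi) /\ compact (closure [set x | psi x != 0]).

(** Only meant for [f] and [g] locally integrable, so that both (real-valued,
    total) integrals are genuine. *)
Definition weak_partial (i : 'I_n) f g : Prop :=
  forall psi, test_function psi ->
    \int[mu]_x (f x * 'D_(e_ i) psi x) = - \int[mu]_x (g x * psi x).

Definition weak_L2_gradient f G : Prop :=
  forall i : 'I_n, (fun x => G x ord0 i) \in Lfun mu 2%:E /\
    weak_partial i f (fun x => G x ord0 i).

Definition W12 : set ('rV[R]_n -> R) :=
  [set f | f \in Lfun mu 2%:E /\ exists G, weak_L2_gradient f G].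

(** A representative of the gradient, which is unique up to a null set. *)
Definition weak_grad f : 'rV[R]_n -> 'rV[R]_n :=
  xget (fun=> 0) (weak_L2_gradient f).

(** The norm [`|v|] of the library on ['rV[R]_n] is the sup norm. *)
Definition euclidean_norm (v : 'rV[R]_n) : R :=
  Num.sqrt (\sum_(i < n) v ord0 i ^+ 2).

(** A real number for [f] in [W12], since the [L^2] norm is then finite. *)
Definition gradL2 f : R :=
  fine ('N[mu]_2%:E[EFin \o (euclidean_norm \o weak_grad f)])%E.

End sobolev.

(** [2n / (n - 2)_+], which is [+oo] when [n <= 2]. *)
Definition sobolev_exponent (R : realType) (n : nat) : \bar R :=
  if (n <= 2)%N then +oo%E else (2 * n%:R / (n%:R - 2))%:E.

(* Main.v *)
(** Put [A = |grad phi|_2] and [beta = (n - 2) / (2 n)].  Testing the weak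
    derivative against products of smooth approximations of indicators of
    intervals shows that, for every set [E] of finite measure, the integral of
    [phi(x) - phi(x + h e_i)] over [E] is the integral over [E] of
    [- \int_0^h d_i phi(x + t e_i) dt].  Taking for [E] the set where
    [phi(x) - phi(x + h e_i) >= c] bounds its measure by [h^2 A^2 / c^2], and
    going from [x] to [x + y] coordinate by coordinate gives
    [|{phi(x) > r, phi(x + y) <= s}| <= n^2 h^2 A^2 / (r - s)^2] for [y] in the
    cube [Q = ]0, h]^n].  Averaging over [y] in [Q] with [|Q| = 2 |{phi > s}|],
    so that at least half of [x + Q] lies in [{phi <= s}], yields
    [|{phi > r}| <= 8 n^2 A^2 / (r - s)^2 |{phi > s}|^(2 / n)].
    This replaces the Sobolev inequality: no truncation of [phi], hence no
    chain rule, is needed.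

    Along the levels [2^k rho], with [rho] of the order of [A m^(- beta)] and
    [|{phi > rho}| <= m], the recursion gives decay faster than [2^(- q k)],
    so that [\int_{phi > rho} phi^q <= C rho^q m].  Now take
    [t = min(A^2, 1)] and [m = K / L(t)], which bounds [|{phi > t}|] by
    Chebyshev.  The hypothesis on [L] makes [L] decay at [0] slower than any
    power, so [phi^q <= C t^(q / 2) L(phi)] where [phi <= t], and [t <= rho].
    The three ranges [phi <= t], [t < phi <= rho], [phi > rho] contribute at
    most [C A^q L(A^2)^(- q (1 / q - beta))] each. *)

Require Import Defs.
From HB Require Import structures.
From mathcomp Require Import all_boot all_order all_algebra.
From mathcomp Require Import all_classical all_reals all_analysis measurable_realfun.
From mathcomp Require Import ring lra zify.
Import Order.TTheory GRing.Theory Num.Theory.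
Import numFieldNormedType.Exports.
Local Open Scope classical_set_scope.
Local Open Scope ring_scope.

Set Implicit Arguments.
Unset Strict Implicit.
Unset Printing Implicit Defensive.

(** * Smooth ramps and tensor test functions *)

(** Level 0 asks for nothing, so [smoothk k.+1] is what yields k continuous derivatives. Carrying
    each derivative as a witness makes closure under sums, products and inverses a plain
    induction. *)
Fixpoint smoothk (R : realType) (k : nat) (g : R -> R) : Prop :=
  if k is k'.+1 then
    exists2 g', (forall x : R, is_derive x 1 g (g' x)) & smoothk k' g'
  else True.

Section smoothk.
Context (R : realType).
Implicit Types (f g : R -> R) (k : nat).

Lemma smoothkW k g : smoothk k.+1 g -> smoothk k g.
Proof.
elim: k g => [//|k IHk] g [g' dg sg]; exists g' => //; exact: IHk.
Qed.

Lemma smoothk_cst k (c : R) : smoothk k (fun=> c).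
Proof.
elim: k c => [//|k IHk] c; exists (fun=> 0) => [x|]; [exact: is_derive_cst|exact: IHk].
Qed.

Lemma smoothk_id k : smoothk k (fun x : R => x).
Proof.
case: k => // k; exists (fun=> 1) => [x|]; [exact: is_derive_id|exact: smoothk_cst].
Qed.

Lemma smoothkD k f g : smoothk k f -> smoothk k g -> smoothk k (fun x => f x + g x).
Proof.
elim: k f g => [//|k IHk] f g [f' df sf] [g' dg sg].
exists (fun x => f' x + g' x) => [x|]; [exact: is_deriveD|exact: IHk].
Qed.

Lemma smoothkM k f g : smoothk k f -> smoothk k g -> smoothk k (fun x => f x * g x).
Proof.
elim: k f g => [//|k IHk] f g sf sg; have [f' df sf'] := sf; have [g' dg sg'] := sg.
exists (fun x => f x * g' x + g x * f' x) => [x|]; first exact: is_deriveM.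
by apply: smoothkD; apply: IHk => //; exact: smoothkW.
Qed.

Lemma smoothkV k f : (forall x, f x != 0) -> smoothk k f -> smoothk k (fun x => (f x)^-1).
Proof.
move=> f0; elim: k => [//|k IHk] sf; have [f' df sf'] := sf.
exists (fun x => -1 * ((f x)^-1 * (f x)^-1) * f' x) => [x|].
  apply: (is_derive_eq (is_deriveV (f0 x) (df x))).
  by rewrite /GRing.scale /= mulN1r -exprVn expr2.
have /IHk sV := smoothkW sf.
by repeat apply: smoothkM => //; exact: smoothk_cst.
Qed.

Lemma is_derive_affine g (dg c d x : R) : is_derive (c * x + d) 1 g dg ->
  is_derive x 1 (fun t => g (c * t + d)) (c * dg).
Proof.
move=> dgx; rewrite mulrC.
have h : is_derive x 1 (fun t : R => c * t + d) c.
  have h1 : is_derive x (1 : R) (fun t : R => c * t) c.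
    apply: (is_derive_eq (is_deriveZ c (is_derive_id x 1))).
    by rewrite /GRing.scale /= mulr1.
  rewrite -[X in is_derive _ _ _ X]addr0.
  exact: (is_deriveD h1 (is_derive_cst d x 1)).
exact: (@is_derive1_comp _ g (fun t => c * t + d)).
Qed.

Lemma smoothk_affine k g (c d : R) : smoothk k g -> smoothk k (fun x => g (c * x + d)).
Proof.
elim: k g => [//|k IHk] g [g' dg sg]; exists (fun x => c * g' (c * x + d)).
  by move=> x; exact: is_derive_affine.
by apply: smoothkM; [exact: smoothk_cst|exact: IHk].
Qed.

Lemma smoothk_continuous g : smoothk 1 g -> continuous g.
Proof.
move=> [g' dg _] x; apply: differentiable_continuous.
by apply/derivable1_diffP; case: (dg x).
Qed.

Lemma is_derive_unique g (x a b : R) :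
  is_derive x 1 g a -> is_derive x 1 g b -> a = b.
Proof. by move=> [_ <-] [_ <-]. Qed.

Lemma smoothk_derive k g g' : smoothk k.+1 g ->
  (forall x : R, is_derive x 1 g (g' x)) -> smoothk k g'.
Proof.
move=> [g1 dg sg] dg'; suff -> : g' = g1 by [].
by apply/funext => x; exact: is_derive_unique (dg' x) (dg x).
Qed.

(** For [m = 0] this is $e^{-1/x}$ extended by zero. The factor $x^{-m}$ gives a family whose
    derivatives are linear combinations of its members. *)
Definition flat (m : nat) (x : R) : R :=
  if 0 < x then x ^- m * expR (- x^-1) else 0.

Lemma flat_ge0 m x : 0 <= flat m x.
Proof.
rewrite /flat; case: ifPn => // x0.
by rewrite mulr_ge0 ?expR_ge0// invr_ge0 exprn_ge0 ?ltW.
Qed.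

(** One term of the exponential series gives $e^{1/x} \ge x^{-(m+2)}/(m+2)!$. The quadratic bound
    makes the difference quotient at 0 vanish. *)
Lemma flat_le m x : flat m x <= (m.+2)`!%:R * x ^+ 2.
Proof.
rewrite /flat; case: ifPn => [x0|_]; last by rewrite mulr_ge0 ?sqr_ge0.
have xm : 0 < x ^+ m by rewrite exprn_gt0.
have xm2 : 0 < x ^+ m.+2 by rewrite exprn_gt0.
have f0 : 0 < (m.+2)`!%:R :> R by rewrite ltr0n fact_gt0.
have := @expR_ge1Dxn R x^-1 m.+1; rewrite invr_ge0 (ltW x0) => /(_ isT) h.
rewrite ler_pdivrMl// expRN.
have h2 : x^-1 ^+ m.+2 / (m.+2)`!%:R <= expR x^-1.
  by apply: le_trans h; rewrite lerDr.
have e0 : 0 < x^-1 ^+ m.+2 / (m.+2)`!%:R by rewrite divr_gt0// exprn_gt0 ?invr_gt0.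
have h3 : (expR x^-1)^-1 <= (x^-1 ^+ m.+2 / (m.+2)`!%:R)^-1.
  by rewrite lef_pV2 ?posrE ?expR_gt0.
apply: (le_trans h3).
rewrite invf_div exprVn invrK. by rewrite [leRHS]mulrCA -exprD addn2 lexx.
Qed.

Lemma is_derive_flat m (x : R) :
  is_derive x 1 (flat m) (flat m.+2 x - m%:R * flat m.+1 x).
Proof.
have [x0|x0|->] := ltgtP x 0.
- rewrite /flat ltNge (ltW x0)/= mulr0 subr0.
  apply: (@near_eq_is_derive _ _ _ (cst 0)).
  near=> y => /=; rewrite ifF//; apply/negbTE; rewrite -leNgt ltW//.
  by near: y; exact: lt_nbhsl.
- have xn0 : x != 0 by rewrite gt_eqF.
  have dV : is_derive x (1:R) (fun y : R => y^-1) (- x ^- 2 *: 1).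
    exact: (@is_deriveV _ id).
  have dNV : is_derive x (1:R) (fun y : R => - y^-1) (- (- x ^- 2 *: 1)).
    exact: is_deriveN.
  have dE : is_derive x (1:R) (fun y : R => expR (- y^-1)) (expR (- x^-1) * (- (- x ^- 2 *: 1))).
    exact: (@is_derive1_comp _ expR (fun y => - y^-1)).
  have xm0 : x ^+ m != 0 by rewrite expf_neq0.
  have dXm : is_derive x (1:R) (fun y : R => y ^+ m) ((m%:R * x ^+ m.-1) *: 1).
    rewrite (_ : (fun y => _) = (id : R -> R) ^+ m); first exact: is_deriveX.
    by apply/funext => y; rewrite exprfctE.
  have dVm := @is_deriveV _ (fun y => y ^+ m) x _ _ xm0 dXm.
  have nE : \near x, (fun y : R => y ^- m * expR (- y^-1)) x = flat m x.
    near=> y => /=; rewrite /flat ifT//.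
    by near: y; exact: lt_nbhsr.
  have D := near_eq_is_derive nE (is_deriveM dVm dE).
  apply: (is_derive_eq D).
  rewrite /flat x0 /GRing.scale /= !mulr1.
  case: m {nE D dVm dXm} xm0 => [|m] xm0 /=.
    by rewrite expr0; field.
  have {}xm0 : x ^+ m != 0 by rewrite expf_neq0.
  by rewrite !exprS; field; rewrite xm0 xn0.
- rewrite /flat ltxx mulr0 subr0.
  set F := flat m; rewrite -/F.
  (* By [flat_le] the quotient at 0 is at most $(m+2)!\,|h|$. *)
  have lim0 : h^-1 *: ((F \o shift 0) (h *: (1:R)) - F 0) @[h --> (0:R)^'] --> (0:R).
    apply/cvgrPdist_lep; near=> e => /=.
    near=> h => /=.
    have e0 : 0 < e by [].
    rewrite sub0r normrN /shift /= addr0 /GRing.scale /= mulr1 {2}/F /flat ltxx subr0 normrM normfV.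
    have h0 : 0 < `|h| by rewrite normr_gt0; near: h; exact: nbhs_dnbhs_neq.
    rewrite ler_pdivrMl// ger0_norm ?flat_ge0//.
    apply: (le_trans (flat_le _ _)).
    rewrite -real_normK ?num_real// expr2 mulrA mulrC ler_wpM2l//.
    rewrite -ler_pdivlMl ?ltr0n ?fact_gt0//.
    near: h; apply: dnbhs0_le.
    by rewrite mulr_gt0// invr_gt0 ltr0n fact_gt0.
  split; first by apply/cvg_ex; exists 0.
  exact: (cvg_lim _ lim0).
Unshelve. all: by end_near. Qed.

Lemma smoothk_flat k m : smoothk k (flat m).
Proof.
elim: k m => [//|k IHk] m.
exists (fun x => flat m.+2 x + -1 * (m%:R * flat m.+1 x)) => [x|].
  by rewrite mulN1r; exact: is_derive_flat.
by apply: smoothkD => //; repeat apply: smoothkM => //; exact: smoothk_cst.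
Qed.

Lemma flat0_gt0 x : 0 < x -> 0 < flat 0 x.
Proof. by rewrite /flat => ->; rewrite expr0 invr1 mul1r expR_gt0. Qed.

Lemma flat_le0 m x : x <= 0 -> flat m x = 0.
Proof. by rewrite /flat ltNge => ->. Qed.

(** A smooth step from 0 to 1. The denominator never vanishes, since [x] and [1 - x] are not both
    nonpositive. *)
Definition sstep (x : R) : R := flat 0 x / (flat 0 x + flat 0 (1 - x)).

Lemma sstep_den x : 0 < flat 0 x + flat 0 (1 - x).
Proof.
have [x0|x0] := ltP 0 x; first by rewrite ltr_pwDl ?flat0_gt0 ?flat_ge0.
by rewrite ltr_wpDl ?flat_ge0// flat0_gt0// subr_gt0 (le_lt_trans x0).
Qed.

Lemma smoothk_sstep k : smoothk k sstep.
Proof.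
apply: smoothkM; first exact: smoothk_flat.
apply: smoothkV => [x|]; first by rewrite gt_eqF ?sstep_den.
apply: smoothkD; first exact: smoothk_flat.
rewrite (_ : (fun x => _) = (fun x => flat 0 (-1 * x + 1))).
  exact/smoothk_affine/smoothk_flat.
by apply/funext => x; rewrite mulN1r addrC.
Qed.

Lemma sstep_le0 x : x <= 0 -> sstep x = 0.
Proof. by move=> x0; rewrite /sstep flat_le0// mul0r. Qed.

Lemma sstep_ge1 x : 1 <= x -> sstep x = 1.
Proof.
move=> x1; rewrite /sstep (@flat_le0 _ (1 - x)) ?subr_le0// addr0 divff//.
by rewrite gt_eqF ?flat0_gt0// (lt_le_trans _ x1).
Qed.

Lemma sstep_norm x : `|sstep x| <= 1.
Proof.
rewrite ger0_norm; last by rewrite divr_ge0 ?flat_ge0 ?(ltW (sstep_den _)).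
by rewrite ler_pdivrMr ?sstep_den// mul1r lerDl flat_ge0.
Qed.

(* [S x = x * sstep x] is exactly [x] for [x > 1], so that second differences
   of [S] have compact support although [S] is not the integral of a step. *)
Lemma smooth_ramp : exists (S s : R -> R) (M : R),
  [/\ forall x : R, is_derive x 1 S (s x),
      forall k, smoothk k S,
      forall x, x <= 0 -> S x = 0 /\ s x = 0,
      forall x, 1 < x -> S x = x /\ s x = 1 &
      forall x, `|S x| <= `|x| /\ `|s x| <= M].
Proof.
pose S (x : R) := x * sstep x.
have sS k : smoothk k S.
  by apply: smoothkM; [exact: smoothk_id|exact: smoothk_sstep].
have [s dS _] := sS 1.
have ss k : smoothk k s by apply: (smoothk_derive (sS k.+1)).
have s1 x : 1 < x -> s x = 1.
  move=> x1; apply: (is_derive_unique (dS x)).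
  apply: (@near_eq_is_derive _ _ _ id) => //.
  near=> y; rewrite /S sstep_ge1 ?mulr1//.
  by apply: ltW; near: y; exact: lt_nbhsr.
(* At 0 itself no neighbourhood lies in the flat region, so the derivative there comes from the
   product rule, both of whose terms vanish. *)
have s0 x : x <= 0 -> s x = 0.
  have [s' ds _] := @smoothk_sstep 1.
  move=> x0; apply: (is_derive_unique (dS x)).
  move: x0; rewrite le_eqVlt => /predU1P[->|x0].
    apply: (is_derive_eq (is_deriveM (is_derive_id (0:R) 1) (ds 0))).
    by rewrite sstep_le0// /GRing.scale /= mul0r mul0r addr0.
  apply: (@near_eq_is_derive _ _ _ (cst 0)) => //.
  near=> y; rewrite /S sstep_le0 ?mulr0//.
  by apply: ltW; near: y; exact: lt_nbhsl.
have cs : continuous s by apply: smoothk_continuous.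
(* As [s] is 0 on the left of 0 and 1 on the right of 1, its bound comes from the maximum of $|s|$
   on $[0,1]$. *)
have [c _ Hc] : exists2 c, c \in `[(0:R), 1] & forall t, t \in `[0, 1] -> `|s t| <= `|s c|.
  apply: (@EVT_max _ (fun t => `|s t|)); first exact: ler01.
  apply: continuous_subspaceT => x; apply: continuous_comp; first exact: cs.
  exact: norm_continuous.
exists S, s, (1 + `|s c|); split=> //.
- by move=> x x0; rewrite s0// /S sstep_le0// mulr0.
- by move=> x x1; rewrite s1// /S sstep_ge1 ?mulr1// ltW.
- move=> x; split; first by rewrite /S normrM ler_piMr// sstep_norm.
  have [x0|x0] := leP x 0; first by rewrite s0// normr0 addr_ge0.
  have [x1|x1] := leP x 1; first by rewrite ler_wpDl// Hc// in_itv/= (ltW x0) x1.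
  by rewrite s1// normr1 lerDl.
Unshelve. all: by end_near. Qed.

End smoothk.

(** * Products of one-variable functions as test functions *)

Section tensor.
Context (R : realType) (n : nat).
Implicit Types (g : 'I_n -> R -> R) (x : 'rV[R]_n).
Local Notation e_ i := (delta_mx ord0 i : 'rV[R]_n).

Definition tensor g x : R := \prod_(j < n) g j (x ord0 j).

(** Differentiating a tensor product along [e_ i] replaces its [i]-th factor by the derivative, so
    tensor products are stable under partial derivatives. *)
Definition upd g (i : 'I_n) (u : R -> R) (j : 'I_n) : R -> R := if j == i then u else g j.

Lemma tensorD1 g i x : tensor g x = g i (x ord0 i) * \prod_(j < n | j != i) g j (x ord0 j).
Proof. by rewrite /tensor (bigD1 i). Qed.

Lemma tensor_updE g i u x :
  tensor (upd g i u) x = u (x ord0 i) * \prod_(j < n | j != i) g j (x ord0 j).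
Proof.
rewrite (tensorD1 _ i) /upd eqxx; congr (_ * _).
by apply: eq_bigr => j /negbTE ->.
Qed.

Lemma is_derive_tensor g i (g' : R -> R) x :
  (forall t : R, is_derive t 1 (g i) (g' t)) ->
  is_derive x (e_ i) (tensor g) (tensor (upd g i g') x).
Proof.
move=> dg; have [dgx gx] := dg (x ord0 i).
rewrite tensor_updE; set P := \prod_(j < n | _) _.
have E (h : R) : h^-1 *: ((tensor g \o shift x) (h *: e_ i) - tensor g x) =
    h^-1 *: ((g i \o shift (x ord0 i)) (h *: (1 : R)) - g i (x ord0 i)) * P.
  rewrite /= !(tensorD1 g i) -/P /shift /= mxE mxE mxE eqxx /=.
  rewrite [X in _ * X - _](_ : _ = P); last first.
    apply: eq_bigr => j ji; congr (g j _).
    by rewrite !mxE eqxx (negbTE ji) mulr0 add0r.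
  by rewrite /GRing.scale /= eqxx -mulrA mulrBl.
have cv : h^-1 *: ((tensor g \o shift x) (h *: e_ i) - tensor g x) @[h --> 0^'] -->
    g' (x ord0 i) * P.
  under eq_fun do rewrite E.
  by apply: cvgMl; rewrite -gx; exact: dgx.
by split; [apply/cvg_ex; eexists; exact: cv|exact: cvg_lim].
Qed.

Lemma continuous_tensor g : (forall j, continuous (g j)) -> continuous (tensor g).
Proof.
move=> cg; rewrite /tensor; elim: (index_enum _) => [|j s IHs] x.
  under eq_fun do rewrite big_nil.
  exact: (@cst_continuous _ _ (1:R) x).
under eq_fun do rewrite big_cons.
apply: continuousM; last exact: IHs.
apply: (@continuous_comp _ _ _ (fun y : 'rV[R]_n => y ord0 j)); last exact: cg.
exact: coord_continuous.
Qed.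

(** The factors have one derivative more than [k], since continuity at the last stage is drawn from
    differentiability. *)
Lemma Ck_tensor k g : (forall j, smoothk k.+1 (g j)) -> Ck k (tensor g).
Proof.
have cs g1 m : (forall j, smoothk m.+1 (g1 j)) -> continuous (tensor g1).
  move=> sg; apply: continuous_tensor => j; apply: smoothk_continuous.
  by elim: m sg => [|m IHm] sg; [exact: sg|apply: IHm => l; exact: smoothkW].
elim: k g => [|k IHk] g sg /=; first exact: cs.
split=> [|i]; first exact: cs.
have [g' dg sg'] := sg i.
have D x := @is_derive_tensor g i g' x dg.
split=> [x|]; first by case: (D x).
rewrite (_ : 'D_(e_ i) (tensor g) = tensor (upd g i g')).
  apply: IHk => j; rewrite /upd; case: ifPn => // _; exact: smoothkW.
by apply/funext => x; case: (D x).
Qed.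

(** A point outside the compact cube $[-B,B]^n$ has a coordinate at which its factor is 0. *)
Lemma tensor_test_function g (B : R) : (forall k j, smoothk k (g j)) ->
  (forall j t, B < `|t| -> g j t = 0) -> test_function (tensor g).
Proof.
move=> sg g0; split=> [k|]; first by apply: Ck_tensor.
pose K := [set v : 'rV[R]_n | forall i, `[(- B), B]%classic (v ord0 i)].
have cK : compact K.
  by apply: (@rV_compact _ _ (fun=> `[(- B), B]%classic)) => i; exact: segment_compact.
apply: (subclosed_compact _ cK); first exact: closed_closure.
have clK : closed K by apply: (@compact_closed _ K) => //; exact: norm_hausdorff.
have /closure_id -> := clK.
apply: closure_subset => x /= gx i /=; rewrite in_itv/= -ler_norml leNgt.
apply/negP => Bx; move/negP: gx; apply; apply/eqP.
by rewrite (tensorD1 _ i) g0// mul0r.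
Qed.

End tensor.

(** * Lebesgue measure on boxes and translations *)


Section density_measure.
Context d (T : measurableType d) (R : realType) (mu : {measure set T -> \bar R}).
Context (f : T -> \bar R) (mf : measurable_fun setT f) (f0 : forall x, (0 <= f x)%E).

(** Viewing the indefinite integral of [f] as a measure lets uniqueness of measures compare two
    integrals over all measurable sets. *)
Definition density_measure (A : set T) : \bar R := (\int[mu]_(x in A) f x)%E.

Let density_measure0 : density_measure set0 = 0%E.
Proof. exact: integral_set0. Qed.

Let density_measure_ge0 A : (0 <= density_measure A)%E.
Proof. exact: integral_ge0. Qed.

Let density_measure_sigma_additive : semi_sigma_additive density_measure.
Proof. exact: semi_sigma_additive_nng_induced. Qed.

HB.instance Definition _ := isMeasure.Build _ _ _ density_measure
  density_measure0 density_measure_ge0 density_measure_sigma_additive.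

Definition densm : {measure set T -> \bar R} := density_measure.

End density_measure.

Section obox.
Context (R : realType) (n : nat).
Local Open Scope ereal_scope.
Local Notation mu := (@lebesgue_rV R n).

(** With sides open on the left and closed on the right, the indicator of a side is exactly the
    difference of the strict steps [a < t] and [b < t], which are pointwise limits of smooth
    functions vanishing up to the jump. *)
Definition obox (a b : 'I_n -> R) : set 'rV[R]_n :=
  [set x | forall i, `]a i, b i]%classic (x ord0 i)].

Lemma measurable_obox a b : measurable (obox a b).
Proof. exact: (@measurable_box _ _ (fun i => `]a i, b i]%classic)). Qed.

Lemma lebesgue_obox a b : mu (obox a b) = \prod_(i < n) lebesgue_measure `]a i, b i]%classic.
Proof. exact: (@lebesgue_rV_box _ _ (fun i => `]a i, b i]%classic)). Qed.

Lemma lebesgue_obox_lty a b : mu (obox a b) < +oo.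
Proof.
rewrite lebesgue_obox.
rewrite (eq_bigr (fun i => (fine (lebesgue_measure `]a i, b i]%classic))%:E)).
  by rewrite prodEFin ltry.
by move=> i _; rewrite fineK// lebesgue_measure_itv/=; case: ifPn.
Qed.

Lemma setI_obox : setI_closed [set obox ab.1 ab.2 | ab in setT].
Proof.
move=> _ _ [[a b] _ <-] [[c d] _ <-] /=.
exists (fun i => Num.max (a i) (c i), fun i => Num.min (b i) (d i)) => //=.
apply/seteqP; split => x /=.
  move=> xab; split=> i; have := xab i => /=; rewrite !in_itv/= gt_max le_min;
  by move=> /andP[/andP[h1 h2] /andP[h3 h4]]; apply/andP.
move=> [xab xcd] i; have := xab i; have := xcd i => /=; rewrite !in_itv/= gt_max le_min.
by move=> /andP[-> ->] /andP[-> ->].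
Qed.

Lemma obox_cover : \bigcup_k obox (fun=> (- k%:R)%R) (fun=> k%:R) = setT.
Proof.
rewrite -subTset => x _.
exists (Num.truncn (\sum_i `|x ord0 i|)).+1 => //= i /=; rewrite in_itv/=.
have h : (`|x ord0 i| < (Num.truncn (\sum_i `|x ord0 i|)).+1%:R)%R.
  apply: le_lt_trans (truncnS_gt _).
  by rewrite (bigD1 i)//= lerDl sumr_ge0.
by move: h; rewrite ltr_norml => /andP[-> /ltW].
Qed.

Lemma measurable_rV_obox :
  @measurable _ 'rV[R]_n = <<s [set obox ab.1 ab.2 | ab in setT] >>.
Proof.
apply/seteqP; split; last first.
  apply: smallest_sub; first exact: sigma_algebra_measurable.
  by move=> _ [[a b] _ <-]; exact: measurable_obox.
apply: smallest_sub; first exact: smallest_sigma_algebra.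
rewrite -bigcup_seq; apply: bigcup_sub => i _ _ [Y mY <-]; rewrite setTI.
pose G : set (set 'rV[R]_n) := [set obox ab.1 ab.2 | ab in setT].
pose H : set (set R) := [set Y | <<s G >> ((fun x : 'rV[R]_n => x ord0 i) @^-1` Y)].
suff : @measurable _ (measurableTypeR R) `<=` H by apply.
apply: smallest_sub.
  split; rewrite /H /=.
  - by rewrite preimage_set0; exact: sigma_algebra0.
  - move=> A GA; rewrite setTD preimage_setC.
    exact: sigma_algebraC.
  - move=> F GF; rewrite preimage_bigcup.
    exact: (sigma_algebra_bigcup).
(* The preimage of an interval under a coordinate is a union of boxes whose other sides are
   $]-k,k]$. *)
move=> _ [[a b] _ <-]; rewrite /H /=.
rewrite (_ : _ @^-1` _ = \bigcup_k
   obox (fun j => if j == i then a else (- k%:R)%R)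
        (fun j => if j == i then b else k%:R)); last first.
  apply/seteqP; split => x /=.
    move=> xab; have : setT x by []; rewrite -obox_cover => -[k _ xk].
    by exists k => // j /=; case: eqP => [->//|_]; exact: xk.
  by move=> [k _ /(_ i)]/=; rewrite eqxx.
apply: sigma_algebra_bigcup => k; apply: sub_sigma_algebra.
by eexists (_, _).
Qed.

(** The boxes form a generating pi-system, and the cubes $]-k,k]^n$, of finite measure, exhaust the
    space. *)
Lemma measure_eq_obox (m1 m2 : {measure set 'rV[R]_n -> \bar R}) :
  (forall a b, m1 (obox a b) = m2 (obox a b)) ->
  (forall a b, m1 (obox a b) < +oo) ->
  forall A, measurable A -> m1 A = m2 A.
Proof.
move=> m12 m1y A mA.
pose g k := obox (fun=> (- k%:R)%R) (fun=> k%:R).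
apply: (@measure_unique _ _ _ _ g measurable_rV_obox setI_obox) => //.
- by move=> i; eexists (_, _).
- exact: obox_cover.
- by move=> _ [[a b] _ <-] /=.
- by move=> k; exact: m1y.
Qed.

Lemma measurable_shift (y : 'rV[R]_n) : measurable_fun setT (fun x : 'rV[R]_n => (x + y)%R).
Proof.
apply: measurable_fun_rV => i.
under eq_fun do rewrite mxE.
by apply: measurable_funD => //; exact: measurable_rV_coord.
Qed.

Let shifted_measure (y : 'rV[R]_n) : {measure set 'rV[R]_n -> \bar R} :=
  measure_function_pushforward__canonical__measure_function_Measure mu
    (measurable_shift y).

(** Translation preserves side lengths, so the measure and its translate agree on boxes. *)
Lemma lebesgue_rV_shift (y : 'rV[R]_n) (A : set 'rV[R]_n) : measurable A ->
  mu ((fun x => (x + y)%R) @^-1` A) = mu A.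
Proof.
move=> mA.
pose m1 := shifted_measure y.
have E a b : m1 (obox a b) = mu (obox a b).
  rewrite /m1 /= /pushforward.
  rewrite (_ : _ @^-1` _ = obox (fun i => a i - y ord0 i)%R (fun i => b i - y ord0 i)%R).
    rewrite !lebesgue_obox; apply: eq_bigr => i _.
    rewrite !lebesgue_measure_itv /= !lte_fin ltrD2r; case: ifPn => // _.
    by rewrite -!EFinB; congr EFin; lra.
  apply/seteqP; split => x /= xab i; have := xab i; rewrite /= !in_itv/= !mxE => /andP[h1 h2];
   by apply/andP; split; lra.
by apply: (measure_eq_obox E) => // a b; rewrite E; exact: lebesgue_obox_lty.
Qed.

Lemma integral_shift (y : 'rV[R]_n) (f : 'rV[R]_n -> \bar R) :
  measurable_fun setT f -> (forall x, 0 <= f x) ->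
  \int[mu]_x f (x + y)%R = \int[mu]_x f x.
Proof.
move=> mf f0.
pose m1 := shifted_measure y.
transitivity (\int[m1]_x f x).
  by rewrite /m1 ge0_integral_pushforward//; exact: measurable_shift.
apply: eq_measure_integral => A mA _.
exact: lebesgue_rV_shift.
Qed.

Lemma eq_integral_obox (f g : 'rV[R]_n -> \bar R) :
  measurable_fun setT f -> (forall x, 0 <= f x) ->
  measurable_fun setT g -> (forall x, 0 <= g x) ->
  (forall a b, \int[mu]_(x in obox a b) f x = \int[mu]_(x in obox a b) g x) ->
  (forall a b, \int[mu]_(x in obox a b) f x < +oo) ->
  forall A, measurable A -> \int[mu]_(x in A) f x = \int[mu]_(x in A) g x.
Proof.
move=> mf f0 mg g0 fg fy A mA.
exact: (@measure_eq_obox (densm mu mf f0) (densm mu mg g0)).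
Qed.

End obox.

(** * Approximation of box indicators and their antiderivatives by test functions *)

Section box_approx.
Context (R : realType) (n : nat).
Implicit Types (g : 'I_n -> R -> R) (x : 'rV[R]_n).
Local Notation e_ i := (delta_mx ord0 i : 'rV[R]_n).

Lemma measurable_tensor g : (forall j, measurable_fun setT (g j)) ->
  measurable_fun setT (tensor g).
Proof.
move=> mg; rewrite /tensor; elim: (index_enum _) => [|j s IHs].
  by under eq_fun do rewrite big_nil; exact: measurable_cst.
under eq_fun do rewrite big_cons.
apply: measurable_funM => //.
exact: (measurableT_comp (mg j) (measurable_rV_coord j)).
Qed.

(** The margin 1 puts the closed cube where the factors may be nonzero inside a half-open box. *)
Lemma tensor_le g (B Q : R) x : (forall j t, `|g j t| <= Q) ->
  (forall j t, B < `|t| -> g j t = 0) ->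
  `|tensor g x| <= Q ^+ n * \1_(obox (fun=> - (B + 1)) (fun=> B + 1)) x.
Proof.
move=> gQ g0.
have [xK|xK] := pselect (obox (fun=> - (B + 1)) (fun=> B + 1) x).
  rewrite indicE mem_set// mulr1 /tensor normr_prod.
  rewrite -[X in Q ^+ X]card_ord -prodr_const.
  by apply: ler_prod => j _; rewrite normr_ge0/=.
rewrite indicE memNset// mulr0 normr_le0.
have [j xj] : exists j, ~ `]- (B + 1), B + 1]%classic (x ord0 j).
  by apply/existsNP => h; exact: xK.
rewrite (tensorD1 _ j) g0 ?mul0r//.
rewrite ltNge; apply/negP; rewrite ler_norml => /andP[h1 h2].
by apply: xj; rewrite /= in_itv/=; apply/andP; split; lra.
Qed.

Definition pos (t : R) : R := Num.max t 0.

(** For $a \le b$ and $h > 0$, the piecewise linear antiderivative, zero near $-\infty$, of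
    $1_{]a,b]}(t) - 1_{]a,b]}(t-h)$. *)
Definition trapezoid (a b h t : R) : R :=
  pos (t - a) - pos (t - b) - pos (t - (a + h)) + pos (t - (b + h)).

(** Away from the corners its derivative along [e_ i] is the indicator of the box minus that of the
    box translated by [h *: e_ i]. *)
Definition box_weight (i : 'I_n) (a b : 'I_n -> R) (h : R) x : R :=
  trapezoid (a i) (b i) h (x ord0 i) *
  \prod_(j < n | j != i) \1_(`]a j, b j]%classic) (x ord0 j).

Lemma indic_obox a b x :
  \1_(obox a b) x = \prod_(j < n) \1_(`]a j, b j]%classic) (x ord0 j) :> R.
Proof.
have [xK|xK] := pselect (obox a b x).
  rewrite indicE mem_set// big1// => j _.
  by rewrite indicE mem_set//; exact: xK.
rewrite indicE memNset//.
have [j xj] : exists j, ~ `]a j, b j]%classic (x ord0 j).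
  by apply/existsNP => h; exact: xK.
by rewrite (bigD1 j)//= indicE memNset// mul0r.
Qed.

Lemma indic_ocitv (a b t : R) : (a <= b)%R ->
  \1_(`]a, b]%classic) t = (a < t)%R%:R - (b < t)%R%:R :> R.
Proof.
move=> ab; rewrite indicE.
have [at_|ta] := ltP a t; last first.
  rewrite memNset/= ?in_itv/= ?ltNge ?ta//= (le_trans ta ab)//=.
  by rewrite subrr.
have [bt|tb] := ltP b t.
  by rewrite memNset/= ?in_itv/= ?at_//= ?leNgt ?bt//= subrr.
by rewrite mem_set/= ?in_itv/= ?at_ ?tb// subr0.
Qed.

(** Products of rescaled ramps. At each point the sequences eventually equal their limits, because a
    ramp is exactly 0 or exactly linear outside an interval of length $1/(k+1)$ to the right of its
    corner. The uniform bound on a fixed cube prepares dominated convergence. *)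
Lemma smooth_box_approx (i : 'I_n) (a b : 'I_n -> R) (h : R) :
  0 < h -> (forall j, a j <= b j) ->
  exists (psi psi' : nat -> 'rV[R]_n -> R) (B D : R),
  [/\ forall k, test_function (psi k) /\ 'D_(e_ i) (psi k) = psi' k,
      forall k, measurable_fun setT (psi k) /\ measurable_fun setT (psi' k),
      forall k x, `|psi k x| <= D * \1_(obox (fun=> - B) (fun=> B)) x /\
                  `|psi' k x| <= D * \1_(obox (fun=> - B) (fun=> B)) x &
      forall x, exists k0, forall k, (k0 <= k)%N ->
        psi k x = box_weight i a b h x /\
        psi' k x = \1_(obox a b) x - \1_(obox a b) (x - h *: e_ i)].
Proof.
move=> h0 ab; have [S [s [M [dS sS S0 S1 SM]]]] := smooth_ramp R.
have ss k : smoothk k s by apply: (smoothk_derive (sS k.+1)).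
have M0 : 0 <= M by apply: le_trans (SM 0).2.
pose N k : R := k.+1%:R.
have N0 k : 0 < N k by [].
(* [Rr k c] smooths the positive part of [t - c]; its derivative [r k c] smooths the step at [c]. *)
pose r k c (t : R) := s (N k * t + - (N k * c)).
pose Rr k c (t : R) := (N k)^-1 * S (N k * t + - (N k * c)).
have argE k c t : N k * t + - (N k * c) = N k * (t - c) by rewrite mulrBr.
have dR k c (t : R) : is_derive t (1:R) (Rr k c) (r k c t).
  apply: (is_derive_eq (is_deriveZ (N k)^-1 (is_derive_affine (dS _)))).
  by rewrite /GRing.scale /= mulrA mulVf ?mul1r// gt_eqF.
have sr m k c : smoothk m (r k c) by exact: smoothk_affine.
have sR m k c : smoothk m (Rr k c).
  by apply: smoothkM; [exact: smoothk_cst|exact: smoothk_affine].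
have r0 k c t : t <= c -> r k c t = 0 /\ Rr k c t = 0.
  move=> tc; rewrite /r /Rr argE.
  have [-> ->] : S (N k * (t - c)) = 0 /\ s (N k * (t - c)) = 0.
    by apply: S0; rewrite pmulr_rle0// subr_le0.
  by rewrite mulr0.
have r1 k c t : 1 < N k * (t - c) -> r k c t = 1 /\ Rr k c t = t - c.
  move=> tc; rewrite /r /Rr argE.
  have [-> ->] := S1 _ tc.
  by rewrite mulKf// gt_eqF.
have r1' k c t : 1 < t - c -> r k c t = 1 /\ Rr k c t = t - c.
  move=> tc; apply: r1; apply: (lt_le_trans tc).
  by rewrite ler_peMl ?ler1n// ltW// (lt_trans _ tc).
have rM k c t : `|r k c t| <= M by exact: (SM _).2.
have RM k c t : `|Rr k c t| <= `|t - c|.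
  rewrite /Rr argE normrM ger0_norm ?invr_ge0 ?(ltW (N0 _))//.
  rewrite ler_pdivrMl//; apply: (le_trans (SM _).1).
  by rewrite normrM (ger0_norm (ltW (N0 k))).
have rlim c t : exists k0, forall k, (k0 <= k)%N ->
    r k c t = (c < t)%R%:R /\ Rr k c t = pos (t - c).
  have [tc|ct] := leP t c.
    by exists 0%N => k _; have [-> ->] := r0 k c t tc; rewrite /pos max_r// subr_le0.
  exists (Num.truncn (t - c)^-1).+1 => k k0.
  have tc0 : 0 < t - c by rewrite subr_gt0.
  have [|-> ->] := r1 k c t; last by rewrite /pos max_l// ltW.
  rewrite -ltr_pdivrMr// div1r; apply: (lt_trans (truncnS_gt _)).
  by rewrite ltr_nat.
(* [T] smooths the indicator of a side, [U] the trapezoid, and [U'] is the derivative of [U]. *)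
pose T k j t := r k (a j) t - r k (b j) t.
pose U k t := Rr k (a i) t - Rr k (b i) t - Rr k (a i + h) t + Rr k (b i + h) t.
pose U' k t := r k (a i) t - r k (b i) t - r k (a i + h) t + r k (b i + h) t.
(* A point beyond [B] in absolute value lies left of all corners or exceeds them all by more than 1,
   where the ramps are exactly linear; in both cases the combinations cancel. *)
pose B := 1 + h + \sum_j (`|a j| + `|b j|).
have aB j : `|a j| + `|b j| + 1 + h <= B.
  rewrite /B (bigD1 j)//=; set X := \sum_(_ < _ | _) _.
  have : 0 <= X by apply: sumr_ge0 => l _; rewrite addr_ge0.
  by lra.
have sT m k j : smoothk m (T k j).
  rewrite (_ : T k j = fun t => r k (a j) t + -1 * r k (b j) t).
    by apply: smoothkD => //; apply: smoothkM => //; exact: smoothk_cst.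
  by apply/funext => t; rewrite mulN1r.
have sU m k : smoothk m (U k).
  rewrite (_ : U k = fun t => Rr k (a i) t + -1 * Rr k (b i) t +
      -1 * Rr k (a i + h) t + Rr k (b i + h) t).
    by repeat (apply: smoothkD => //); apply: smoothkM => //; exact: smoothk_cst.
  by apply/funext => t; rewrite !mulN1r.
have dU k (t : R) : is_derive t (1:R) (U k) (U' k t).
  apply: is_deriveD => //; apply: is_deriveB => //; exact: is_deriveB.
have sU' m k : smoothk m (U' k) by apply: (smoothk_derive (sU m.+1 k)).
have farT k j t : B < `|t| -> T k j t = 0.
  move=> Bt; have {}Bt := le_lt_trans (aB j) Bt.
  have := ler_norm (- a j); have := ler_norm (- b j); rewrite !normrN.
  have := ler_norm (a j); have := ler_norm (b j).
  have := normr_ge0 (a j); have := normr_ge0 (b j) => b0 a0 b1 a1 b2 a2.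
  have [t0|t0] := leP t 0.
    rewrite (ler0_norm t0) in Bt.
    by rewrite /T !(r0 _ _ _ _).1 ?subrr//; lra.
  rewrite (gtr0_norm t0) in Bt.
  by rewrite /T !(r1' _ _ _ _).1 ?subrr//; lra.
have farU k t : B < `|t| -> U k t = 0 /\ U' k t = 0.
  move=> Bt; have {}Bt := le_lt_trans (aB i) Bt.
  have := ler_norm (- a i); have := ler_norm (- b i); rewrite !normrN.
  have := ler_norm (a i); have := ler_norm (b i).
  have := normr_ge0 (a i); have := normr_ge0 (b i) => b0 a0 b1 a1 b2 a2.
  have [t0|t0] := leP t 0.
    rewrite (ler0_norm t0) in Bt.
    by rewrite /U /U' !(r0 _ _ _ _).1 ?(r0 _ _ _ _).2 ?subrr ?addr0//; lra.
  rewrite (gtr0_norm t0) in Bt.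
  rewrite /U /U' !(r1' _ _ _ _).1 ?(r1' _ _ _ _).2//; lra.
pose gp k := upd (T k) i (U k).
pose gp' k := upd (T k) i (U' k).
have far k j t : B < `|t| -> gp k j t = 0 /\ gp' k j t = 0.
  by move=> Bt; rewrite /gp /gp' /upd; case: eqP => _; [exact: farU|rewrite farT].
(* Four ramps, each at most [2 * B] for $|t| \le B$, and four slopes, each at most [M]. *)
pose Q := 8 * B + 4 * M.
have B0 : 0 <= B by rewrite /B !addr_ge0// ?(ltW h0)// sumr_ge0// => l _; rewrite addr_ge0.
have bd k j t : `|gp k j t| <= Q /\ `|gp' k j t| <= Q.
  have [Bt|tB] := ltP B `|t|.
    by have [-> ->] := far k j t Bt; rewrite normr0 addr_ge0 ?mulr_ge0.
  have TM j' : `|T k j' t| <= Q.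
    apply: (le_trans (ler_normB _ _)); have := rM k (a j') t; have := rM k (b j') t.
    by rewrite /Q; lra.
  rewrite /gp /gp' /upd; case: eqP => _ //; split.
    have Rb c : `|c| <= B -> `|Rr k c t| <= 2 * B.
      move=> cB; apply: (le_trans (RM _ _ _)); apply: (le_trans (ler_normB _ _)).
      by lra.
    have ai := aB i; have := normr_ge0 (a i); have := normr_ge0 (b i) => b0 a0.
    have := Rb (a i); have := Rb (b i); have := Rb (a i + h); have := Rb (b i + h).
    have ah : `|a i + h| <= B by apply: (le_trans (ler_normD _ _)); rewrite (gtr0_norm h0); lra.
    have bh : `|b i + h| <= B by apply: (le_trans (ler_normD _ _)); rewrite (gtr0_norm h0); lra.
    move=> /(_ bh) h1 /(_ ah) h2 h3 h4.
    have {}h3 : `|Rr k (b i) t| <= 2 * B by apply: h3; lra.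
    have {}h4 : `|Rr k (a i) t| <= 2 * B by apply: h4; lra.
    rewrite /U /Q; apply: (le_trans (ler_normD _ _)).
    have := ler_normB (Rr k (a i) t - Rr k (b i) t) (Rr k (a i + h) t).
    have := ler_normB (Rr k (a i) t) (Rr k (b i) t).
    by lra.
  have := rM k (a i) t; have := rM k (b i) t; have := rM k (a i + h) t; have := rM k (b i + h) t.
  move=> h1 h2 h3 h4.
  rewrite /U' /Q; apply: (le_trans (ler_normD _ _)).
  have := ler_normB (r k (a i) t - r k (b i) t) (r k (a i + h) t).
  have := ler_normB (r k (a i) t) (r k (b i) t).
  by lra.
have mT k j : measurable_fun setT (T k j).
  by apply: continuous_measurable_fun; apply: smoothk_continuous.
have mU k : measurable_fun setT (U k).
  by apply: continuous_measurable_fun; apply: smoothk_continuous.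
have mU' k : measurable_fun setT (U' k).
  by apply: continuous_measurable_fun; apply: smoothk_continuous.
exists (fun k => tensor (gp k)), (fun k => tensor (gp' k)), (B + 1), (Q ^+ n); split.
- move=> k; split.
    apply: (@tensor_test_function _ _ _ B) => [m j|j t /far Bt]; last exact: (Bt k j).1.
    by rewrite /gp /upd; case: eqP.
  apply/funext => x.
  have D := @is_derive_tensor _ _ (gp k) i (U' k) x.
  have [|_ ->] := D; first by move=> t; rewrite /gp /upd eqxx.
  by rewrite !tensor_updE; congr (_ * _); apply: eq_bigr => j ji; rewrite /gp /upd (negbTE ji).
- by move=> k; split; apply: measurable_tensor => j; rewrite /gp /gp' /upd; case: eqP.
- move=> k x; split; apply: tensor_le => j t; try by move=> /(far k j)[].
    exact: (bd k j t).1.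
  exact: (bd k j t).2.
- move=> x.
  have [ka Ha] : exists ka : 'I_n -> nat, forall j k, (ka j <= k)%N ->
      T k j (x ord0 j) = \1_(`]a j, b j]%classic) (x ord0 j).
    suff /choice[ka Hka] : forall j, exists ka, forall k, (ka <= k)%N ->
        T k j (x ord0 j) = \1_(`]a j, b j]%classic) (x ord0 j) by exists ka.
    move=> j; have [k1 H1] := rlim (a j) (x ord0 j); have [k2 H2] := rlim (b j) (x ord0 j).
    exists (maxn k1 k2) => k; rewrite geq_max => /andP[/H1[+ _] /H2[+ _]].
    by rewrite /T indic_ocitv// => -> ->.
  set t := x ord0 i.
  have [k1 H1] := rlim (a i) t; have [k2 H2] := rlim (b i) t.
  have [k3 H3] := rlim (a i + h) t; have [k4 H4] := rlim (b i + h) t.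
  exists (\max_j ka j + (k1 + k2 + k3 + k4))%N => k kk.
  have {}Ha j : T k j (x ord0 j) = \1_(`]a j, b j]%classic) (x ord0 j).
    by apply: Ha; apply: leq_trans kk; apply: leq_trans (leq_addr _ _); exact: leq_bigmax.
  have [e1 E1] : r k (a i) t = (a i < t)%R%:R /\ Rr k (a i) t = pos (t - a i) by apply: H1; lia.
  have [e2 E2] : r k (b i) t = (b i < t)%R%:R /\ Rr k (b i) t = pos (t - b i) by apply: H2; lia.
  have [e3 E3] : r k (a i + h) t = (a i + h < t)%R%:R /\
      Rr k (a i + h) t = pos (t - (a i + h)) by apply: H3; lia.
  have [e4 E4] : r k (b i + h) t = (b i + h < t)%R%:R /\
      Rr k (b i + h) t = pos (t - (b i + h)) by apply: H4; lia.
  rewrite /gp /gp' !tensor_updE.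
  have -> : \prod_(j < n | j != i) T k j (x ord0 j) =
            \prod_(j < n | j != i) \1_(`]a j, b j]%classic) (x ord0 j) by apply: eq_bigr.
  split; first by rewrite /box_weight /U -/t E1 E2 E3 E4.
  have oD y : \1_(obox a b) y = \1_(`]a i, b i]%classic) (y ord0 i) *
      \prod_(j < n | j != i) \1_(`]a j, b j]%classic) (y ord0 j) :> R.
    by rewrite indic_obox (bigD1 i).
  rewrite !oD.
  have -> : \prod_(j < n | j != i) \1_(`]a j, b j]%classic) ((x - h *: e_ i) ord0 j) =
            \prod_(j < n | j != i) \1_(`]a j, b j]%classic) (x ord0 j) :> R.
    by apply: eq_bigr => j ji; congr (\1_ _ _); rewrite !mxE eqxx (negbTE ji) mulr0 subr0.
  rewrite -mulrBl; congr (_ * _).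
  rewrite /U' -/t e1 e2 e3 e4 !mxE !eqxx mulr1 -/t !indic_ocitv//.
  rewrite !ltrBrDr; ring.
Qed.

End box_approx.

(** * Weak derivatives and translations *)


Section weak_box.
Context (R : realType) (n : nat).
Local Notation mu := (@lebesgue_rV R n).
Local Notation e_ i := (delta_mx ord0 i : 'rV[R]_n).

Lemma integrable_indic_obox a b : mu.-integrable setT (EFin \o \1_(obox a b)).
Proof.
apply/integrableP; split.
  by apply/measurable_EFinP/measurable_indicP; exact: measurable_obox.
under eq_integral do rewrite /= ger0_norm//.
by rewrite integral_indic ?setIT ?lebesgue_obox_lty//; exact: measurable_obox.
Qed.

(** On the box, which has finite measure, $|f| \le f^2 + 1$. *)
Lemma integrable_sqr_obox (f : 'rV[R]_n -> R) a b : measurable_fun setT f ->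
  mu.-integrable setT (EFin \o (fun x => f x ^+ 2)) ->
  mu.-integrable setT (EFin \o (fun x => f x * \1_(obox a b) x)).
Proof.
move=> mf f2.
apply: (le_integrable _ _ _ (integrableD _ f2 (integrable_indic_obox a b))) => //.
  apply/measurable_EFinP; apply: measurable_funM => //.
  by apply/measurable_indicP; exact: measurable_obox.
move=> x _ /=; rewrite lee_fin normrM indicE.
case: (x \in obox a b); rewrite /= ?mulr0 ?mulr1 ?normr0 ?mulr0 ?normr1 ?mulr1//.
rewrite [leRHS]ger0_norm ?addr_ge0 ?sqr_ge0// -(real_normK (num_real (f x))).
have := normr_ge0 (f x); set y := `|f x|; nra.
Qed.

Lemma eventually_eq_cvg (u : nat -> R) (l : R) :
  (exists k0, forall k, (k0 <= k)%N -> u k = l) -> u @ \oo --> l.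
Proof.
move=> [k0 H]; apply: cvg_near_cst; exists k0 => // k /= kk; exact: H.
Qed.

Lemma dominated_obox (F : 'rV[R]_n -> R) (u_ : nat -> 'rV[R]_n -> R) u (B D : R) :
  measurable_fun setT F ->
  mu.-integrable setT (EFin \o (fun x => F x * \1_(obox (fun=> - B) (fun=> B)) x)) ->
  (forall k, measurable_fun setT (u_ k)) ->
  (forall k x, `|u_ k x| <= D * \1_(obox (fun=> - B) (fun=> B)) x) ->
  (forall x, exists k0, forall k, (k0 <= k)%N -> u_ k x = u x) ->
  [/\ forall k, mu.-integrable setT (EFin \o (fun x => F x * u_ k x)),
      measurable_fun setT u,
      mu.-integrable setT (EFin \o (fun x => F x * u x)) &
      \int[mu]_x (F x * u_ k x) @[k --> \oo] --> \int[mu]_x (F x * u x)].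
Proof.
move=> mF iF mu_ bu_ u_u.
have muu : measurable_fun setT u.
  apply: (measurable_fun_cvg mu_) => x _; exact: eventually_eq_cvg.
pose g x := D * (F x * \1_(obox (fun=> - B) (fun=> B)) x).
have ig : mu.-integrable setT (EFin \o (fun x => `|g x|)).
  apply: integrable_norm.
  exact: integrableZl iF.
have bd k x : `|F x * u_ k x| <= `|g x|.
  have := bu_ k x; rewrite /g indicE; case: (x \in _) => /=.
    by rewrite !mulr1 => h; rewrite !normrM mulrC ler_wpM2r// (le_trans h)// ler_norm.
  by rewrite mulr0 normr_le0 => /eqP ->; rewrite !mulr0 normr0.
have ik k : mu.-integrable setT (EFin \o (fun x => F x * u_ k x)).
  apply: (le_integrable _ _ _ ig) => //.
    by apply/measurable_EFinP; exact: measurable_funM.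
  by move=> x _; rewrite /= lee_fin normr_id.
pose v k := EFin \o (fun x => F x * u_ k x); pose v' := EFin \o (fun x => F x * u x).
have [iu _ cu] : [/\ mu.-integrable setT v',
   [sequence (\int[mu]_(x in setT) `|v k x - v' x|)%E]_k @ \oo --> 0%E &
   [sequence (\int[mu]_(x in setT) v k x)%E]_k @ \oo --> (\int[mu]_(x in setT) v' x)%E].
  apply: (dominated_convergence _ _ _ _ ig) => //.
  - by move=> k; apply/measurable_EFinP; exact: measurable_funM.
  - by apply/measurable_EFinP; exact: measurable_funM.
  - apply/nearW => x _ /=; apply: cvg_EFin; first exact: nearW.
    apply: eventually_eq_cvg; have [k0 H] := u_u x; exists k0 => k kk /=.
    by rewrite H.
  - by apply/nearW => x k _ /=; rewrite lee_fin; exact: bd.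
split=> //.
rewrite /Rintegral; apply: fine_cvg.
rewrite fineK; last exact: integrable_fin_num.
exact: cu.
Qed.

(* Only test functions with a measurable derivative are kept, so that the
   property survives a change of [f] on a null set. *)
Definition measurably_weak_partial (i : 'I_n) (f g : 'rV[R]_n -> R) : Prop :=
  forall psi, test_function psi -> measurable_fun setT ('D_(e_ i) psi) ->
    \int[mu]_x (f x * 'D_(e_ i) psi x) = - \int[mu]_x (g x * psi x).

(** The weak derivative identity passes from test functions to the Lipschitz weight [box_weight] in
    the limit along [smooth_box_approx]. *)
Lemma weak_partial_obox i (f G : 'rV[R]_n -> R) a b h :
  measurable_fun setT f -> mu.-integrable setT (EFin \o (fun x => f x ^+ 2)) ->
  measurable_fun setT G -> mu.-integrable setT (EFin \o (fun x => G x ^+ 2)) ->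
  measurably_weak_partial i f G -> 0 < h -> (forall j, a j <= b j) ->
  [/\ measurable_fun setT (box_weight i a b h),
      mu.-integrable setT (EFin \o (fun x => G x * box_weight i a b h x)),
      mu.-integrable setT (EFin \o (fun x => f x * \1_(obox a b) (x - h *: e_ i))) &
      \int[mu]_x (f x * \1_(obox a b) x) - \int[mu]_x (f x * \1_(obox a b) (x - h *: e_ i)) =
      - \int[mu]_x (G x * box_weight i a b h x)].
Proof.
move=> mf f2 mG G2 wfG h0 ab.
have [psi [psi' [B [D [tpsi mpsi bpsi cpsi]]]]] := smooth_box_approx i h0 ab.
have fB := integrable_sqr_obox (fun=> - B) (fun=> B) mf f2.
have GB := integrable_sqr_obox (fun=> - B) (fun=> B) mG G2.
have [_ mw iGw cGw] := @dominated_obox G psi (box_weight i a b h) B D mG GB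
  (fun k => (mpsi k).1) (fun k x => (bpsi k x).1)
  (fun x => let: ex_intro k0 H := cpsi x in ex_intro _ k0 (fun k kk => (H k kk).1)).
have [_ mv ifv cfv] := @dominated_obox f psi'
  (fun x => \1_(obox a b) x - \1_(obox a b) (x - h *: e_ i)) B D mf fB
  (fun k => (mpsi k).2) (fun k x => (bpsi k x).2)
  (fun x => let: ex_intro k0 H := cpsi x in ex_intro _ k0 (fun k kk => (H k kk).2)).
have E k : \int[mu]_x (f x * psi' k x) = - \int[mu]_x (G x * psi k x).
  by have [tk Dk] := tpsi k; rewrite -Dk; apply: wfG => //; rewrite Dk; exact: (mpsi k).2.
have ifB := integrable_sqr_obox a b mf f2.
(* The translated indicator is the box indicator minus the limit of the derivatives, so
   integrability follows by subtraction. *)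
have ifB' : mu.-integrable setT (EFin \o (fun x => f x * \1_(obox a b) (x - h *: e_ i))).
  have := integrableB measurableT ifB ifv; congr (integrable _ _ _).
  by apply/funext => x /=; rewrite -EFinB; congr EFin; ring.
split => //.
rewrite -RintegralB//.
under eq_Rintegral do rewrite -mulrBr.
transitivity (limn (fun k => \int[mu]_x (f x * psi' k x))).
  by apply/esym/cvg_lim => //; exact: cfv.
apply/cvg_lim => //.
under eq_fun do rewrite E.
exact: cvgN cGw.
Qed.

End weak_box.

(** * Integrals along segments parallel to an axis *)

Section slide.
Context (R : realType) (n : nat).
Local Notation mu := (@lebesgue_rV R n).
Local Notation leb := (@lebesgue_measure R).
Local Notation e_ i := (delta_mx ord0 i : 'rV[R]_n).
Implicit Types (g : 'rV[R]_n -> R) (x : 'rV[R]_n).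

(** The integral of [g] over the segment from [x] to [x + h *: e_ i]. The indicator inside an
    integral over the whole line puts the kernel on a full product, ready for Tonelli. *)
Definition slide (i : 'I_n) (h : R) g x : \bar R :=
  (\int[leb]_t (g (x + t *: e_ i) * \1_(`[0%R, h[%classic : set R) t)%:E)%E.

Let T2 := ('rV[R]_n * measurableTypeR R)%type.

Lemma measurable_translate (i : 'I_n) :
  measurable_fun setT (fun z : T2 => z.1 + (z.2 : R) *: e_ i).
Proof.
apply: measurable_fun_rV => j.
under eq_fun do rewrite !mxE.
apply: measurable_funD.
  exact: (measurableT_comp (measurable_rV_coord j) measurable_fst).
apply: measurable_funM; last exact: measurable_cst.
exact: measurable_snd.
Qed.

Lemma measurable_translateN (i : 'I_n) :
  measurable_fun setT (fun z : T2 => z.1 - (z.2 : R) *: e_ i).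
Proof.
apply: measurable_fun_rV => j.
under eq_fun do rewrite !mxE.
apply: measurable_funB.
  exact: (measurableT_comp (measurable_rV_coord j) measurable_fst).
apply: measurable_funM; last exact: measurable_cst.
exact: measurable_snd.
Qed.

Lemma measurable_indic_itv_snd (h : R) :
  measurable_fun setT (fun z : T2 => \1_(`[0%R, h[%classic : set R) z.2 : R).
Proof.
apply: (measurableT_comp _ measurable_snd).
by apply/measurable_indicP; exact: measurable_itv.
Qed.

Lemma measurable_slide_kernel i h g : measurable_fun setT g ->
  measurable_fun setT (fun z : T2 =>
    (g (z.1 + (z.2 : R) *: e_ i) * \1_(`[0%R, h[%classic : set R) z.2)%:E).
Proof.
move=> mg.
apply/measurable_EFinP; apply: measurable_funM; last exact: measurable_indic_itv_snd.
exact: (measurableT_comp mg (measurable_translate i)).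
Qed.

Lemma measurable_slide i h g : measurable_fun setT g -> (forall x, 0 <= g x) ->
  measurable_fun setT (slide i h g).
Proof.
move=> mg g0.
apply: (measurable_fun_fubini_tonelli_F (m2 := leb) _ (measurable_slide_kernel i h mg)).
by move=> z; rewrite lee_fin mulr_ge0.
Qed.

Lemma slide_ge0 i h g x : (forall x, 0 <= g x) -> (0 <= slide i h g x)%E.
Proof. by move=> g0; apply: integral_ge0 => t _; rewrite lee_fin mulr_ge0. Qed.

(** After exchanging the integrals, a translation by [t *: e_ i] at fixed [t] moves the shift from
    [g] onto the indicator of [A]. *)
Lemma integral_slide i h g (A : set 'rV[R]_n) : measurable A ->
  measurable_fun setT g -> (forall x, 0 <= g x) ->
  (\int[mu]_(x in A) slide i h g x =
   \int[mu]_x \int[leb]_t (g x * (\1_(`[0%R, h[%classic : set R) t * \1_A (x - t *: e_ i)))%:E)%E.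
Proof.
move=> mA mg g0.
pose F (z : T2) := (g (z.1 + (z.2 : R) *: e_ i) * \1_(`[0%R, h[%classic : set R) z.2 * \1_A z.1)%:E.
pose H (z : T2) :=
  (g z.1 * (\1_(`[0%R, h[%classic : set R) z.2 * \1_A (z.1 - (z.2 : R) *: e_ i)))%:E.
have mgt := measurableT_comp mg (measurable_translate i).
have m1A : measurable_fun setT (\1_A : _ -> R) by exact/measurable_indicP.
have mF : measurable_fun setT F.
  apply/measurable_EFinP; apply: measurable_funM.
    by apply: measurable_funM; [exact: mgt|exact: measurable_indic_itv_snd].
  exact: (measurableT_comp m1A measurable_fst).
have mH : measurable_fun setT H.
  apply/measurable_EFinP; apply: measurable_funM.
    exact: (measurableT_comp mg measurable_fst).
  apply: measurable_funM; first exact: measurable_indic_itv_snd.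
  exact: (measurableT_comp m1A (measurable_translateN i)).
have F0 z : (0 <= F z)%E by rewrite lee_fin !mulr_ge0.
have H0 z : (0 <= H z)%E by rewrite lee_fin !mulr_ge0.
transitivity (\int[mu]_x \int[leb]_t F (x, t))%E.
  rewrite integral_mkcond epatch_indic; apply: eq_integral => x _ /=.
  rewrite /slide -ge0_integralZr//.
  - exact: (measurable_fun_pair2 x (measurable_slide_kernel i h mg)).
  - by move=> t _; rewrite lee_fin mulr_ge0.
rewrite (fubini_tonelli F mF F0) [RHS](fubini_tonelli H mH H0).
apply: eq_integral => t _ /=.
rewrite -[RHS](integral_shift (t *: e_ i)) /=.
- apply: eq_integral => x _; by rewrite /F /H /= addrK mulrA.
- exact: (measurable_fun_pair1 (t : measurableTypeR R) mH).
- by move=> x; exact: (H0 (x, t)).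
Qed.

(** The trapezoid is the convolution of two indicators: the [t] in $[0,h[$ with $s-t$ in $]a,b]$
    form the interval [J], and its length is the trapezoid at [s]. *)
Lemma integral_trapezoid (a b h s : R) : 0 < h -> a <= b ->
  (\int[leb]_t (\1_(`[0%R, h[%classic : set R) t * \1_(`]a, b]%classic : set R) (s - t))%:E =
   (trapezoid a b h s)%:E)%E.
Proof.
move=> h0 ab.
pose J : set R := `[Num.max 0 (s - b), Num.min h (s - a)[%classic.
transitivity (leb J).
  transitivity (\int[leb]_t (\1_J t)%:E)%E; last first.
    by rewrite integral_indic ?setIT//; exact: measurable_itv.
  apply: eq_integral => t _; rewrite !indicE -natrM mulnb; congr ((nat_of_bool _)%:R%:E).
  apply/andP/idP; rewrite !inE /J /= !in_itv/= ge_max lt_min.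
    by move=> [/andP[h1 h2] /andP[h3 h4]]; apply/andP; split; apply/andP; split => //; lra.
  by move=> /andP[/andP[h1 h2] /andP[h3 h4]]; split; apply/andP; split => //; lra.
rewrite /J lebesgue_measure_itv/= lte_fin /trapezoid /pos.
case: ltP => hlt; rewrite -?EFinB; congr EFin; move: hlt;
  case: (leP 0 (s - b)) => ?; case: (leP h (s - a)) => ?; case: (leP 0 (s - a)) => ?;
  case: (leP 0 (s - (a + h))) => ?; case: (leP 0 (s - (b + h))) => ? ?; lra.
Qed.

Lemma box_weight_ge0 i a b h x : 0 < h -> (forall j, a j <= b j) -> 0 <= box_weight i a b h x.
Proof.
move=> h0 ab; apply: mulr_ge0; last by apply: prodr_ge0.
rewrite -lee_fin -(integral_trapezoid _ h0 (ab i)); apply: integral_ge0 => t _.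
by rewrite lee_fin mulr_ge0.
Qed.

(** Identifies the weight coming from the weak derivative with the one coming from segments that
    start in the box. *)
Lemma integral_slide_obox i h g a b : 0 < h -> (forall j, a j <= b j) ->
  measurable_fun setT g -> (forall x, 0 <= g x) ->
  (\int[mu]_(x in obox a b) slide i h g x = \int[mu]_x (g x * box_weight i a b h x)%:E)%E.
Proof.
move=> h0 ab mg g0; rewrite integral_slide//; last exact: measurable_obox.
apply: eq_integral => x _.
rewrite /box_weight; set P := \prod_(j < n | j != i) _.
have P0 : 0 <= P by apply: prodr_ge0.
transitivity ((g x * P)%:E * \int[leb]_t (\1_(`[0%R, h[%classic : set R) t *
    \1_(`]a i, b i]%classic : set R) (x ord0 i - t))%:E)%E; last first.
  by rewrite integral_trapezoid// -EFinM; congr EFin; ring.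
rewrite -ge0_integralZl//.
- apply: eq_integral => t _; rewrite -EFinM; congr EFin.
  rewrite indic_obox (bigD1 i)//= !mxE !eqxx mulr1.
  have -> : \prod_(j < n | j != i) \1_(`]a j, b j]%classic) ((x - t *: e_ i) ord0 j) = P.
    by apply: eq_bigr => j ji; congr (\1_ _ _); rewrite !mxE eqxx (negbTE ji) mulr0 subr0.
  by ring.
- apply/measurable_EFinP; apply: measurable_funM.
    by apply/measurable_indicP; exact: measurable_itv.
  pose u : R -> R := \1_(`]a i, b i]%classic).
  apply: (@measurableT_comp _ _ _ _ _ _ u).
    by apply/measurable_indicP; exact: measurable_itv.
  exact: measurable_funB.
- by rewrite lee_fin mulr_ge0.
Qed.

Lemma integral_slideT i h g : 0 < h ->
  measurable_fun setT g -> (forall x, 0 <= g x) ->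
  (\int[mu]_x slide i h g x = h%:E * \int[mu]_x (g x)%:E)%E.
Proof.
move=> h0 mg g0; rewrite integral_slide//.
rewrite -ge0_integralZl//.
- apply: eq_integral => x _.
  under eq_integral do rewrite indicT mulr1 EFinM.
  rewrite ge0_integralZl//.

  + rewrite integral_indic// setIT.
    transitivity ((g x)%:E * leb (`[0%R, h[%classic : set R))%E => //.
    by rewrite lebesgue_measure_itv/= lte_fin h0 sube0 muleC.
  + by apply/measurable_EFinP/measurable_indicP; exact: measurable_itv.
  + by rewrite lee_fin.
- exact/measurable_EFinP.
- by move=> x _; rewrite lee_fin.
- by rewrite lee_fin ltW.
Qed.

End slide.

(** Since $u \ge v + c$ on [E] and $s \ge 0$, one has $\int v + c\,\mu(E) \le \int v + \int t$, and
    the finite $\int v$ cancels. *)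
Lemma le_integral_balance d (T : measurableType d) (R : realType)
    (mu : {measure set T -> \bar R}) (E : set T) (u v : T -> R) (s t : T -> \bar R) (c : R) :
  measurable E -> measurable_fun E u -> measurable_fun E v -> measurable_fun E s ->
  measurable_fun E t -> (forall x, 0 <= u x) -> (forall x, 0 <= v x) ->
  (forall x, 0 <= s x)%E -> (forall x, 0 <= t x)%E -> 0 <= c ->
  (forall x, E x -> c <= u x - v x) ->
  (\int[mu]_(x in E) (v x)%:E < +oo)%E ->
  (\int[mu]_(x in E) ((u x)%:E + s x) = \int[mu]_(x in E) ((v x)%:E + t x))%E ->
  (c%:E * mu E <= \int[mu]_(x in E) t x)%E.
Proof.
move=> mE /measurable_EFinP mU /measurable_EFinP mV ms mt u0 v0 s0 t0 c0 cuv vy B.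
have vf : (\int[mu]_(x in E) (v x)%:E)%E \is a fin_num.
  by rewrite ge0_fin_numE//; apply: integral_ge0 => x _; rewrite lee_fin.
rewrite -(leeD2lE _ _ vf) -integral_cst// -!ge0_integralD//; try by move=> x _; rewrite lee_fin.
rewrite -B; apply: ge0_le_integral => //.
- by move=> x _; rewrite -EFinD lee_fin addr_ge0.
- exact: emeasurable_funD.
- exact: emeasurable_funD.
move=> x Ex; rewrite -[leLHS]adde0 leeD// -EFinD lee_fin.
by have := cuv x Ex; lra.
Qed.

(** * Differences along one coordinate axis *)

Section translate_estimate.
Context (R : realType) (n : nat).
Local Notation mu := (@lebesgue_rV R n).
Local Notation e_ i := (delta_mx ord0 i : 'rV[R]_n).
Context (i : 'I_n) (f G : 'rV[R]_n -> R) (h : R).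
Hypothesis mf : measurable_fun setT f.
Hypothesis f0 : forall x, 0 <= f x.
Hypothesis f2 : mu.-integrable setT (EFin \o (fun x => f x ^+ 2)).
Hypothesis mG : measurable_fun setT G.
Hypothesis G2 : mu.-integrable setT (EFin \o (fun x => G x ^+ 2)).
Hypothesis wfG : measurably_weak_partial i f G.
Hypothesis h0 : 0 < h.

Let Gp x := Num.max (G x) 0.
Let Gm x := Num.max (- G x) 0.

Let mGp : measurable_fun setT Gp.
Proof. by apply: measurable_maxr => //; exact: measurable_cst. Qed.

Let mGm : measurable_fun setT Gm.
Proof.
apply: measurable_maxr; last exact: measurable_cst.
exact: measurable_funN.
Qed.

Let Gp0 x : 0 <= Gp x. Proof. by rewrite /Gp le_max lexx orbT. Qed.
Let Gm0 x : 0 <= Gm x. Proof. by rewrite /Gm le_max lexx orbT. Qed.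

Let fh x := f (x + h *: e_ i).
Let fh0 x : 0 <= fh x. Proof. exact: f0. Qed.
Let mfh : measurable_fun setT fh.
Proof. exact: (measurableT_comp mf (measurable_shift _)). Qed.

(** [F1 = F2] encodes $f(x) - f(x+he_i) = -\int_0^h G(x+te_i)\,dt$. Splitting [G] into its positive
    and negative parts keeps both sides nonnegative, so that no infinite values are subtracted. *)
Let F1 x := ((f x)%:E + slide i h Gp x)%E.
Let F2 x := ((fh x)%:E + slide i h Gm x)%E.

Lemma obox_unordered (a b : 'I_n -> R) j : b j < a j -> obox a b = set0.
Proof.
move=> ba; apply/seteqP; split => // x /(_ j) /=; rewrite in_itv/= => /andP[h1 h2].
by have := lt_le_trans h1 h2; rewrite ltNge (ltW ba).
Qed.

Lemma balance_obox a b : (forall j, a j <= b j) ->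
  (\int[mu]_(x in obox a b) F1 x = \int[mu]_(x in obox a b) F2 x)%E /\
  (\int[mu]_(x in obox a b) F1 x < +oo)%E.
Proof.
move=> ab.
have [mw iGw ifh E] := @weak_partial_obox _ _ i f G a b h mf f2 mG G2 wfG h0 ab.
have ifB := integrable_sqr_obox a b mf f2.
have w0 x := box_weight_ge0 i x h0 ab.
have iGpw : mu.-integrable setT (EFin \o (fun x => Gp x * box_weight i a b h x)).
  apply: (le_integrable _ _ _ iGw) => //.
    by apply/measurable_EFinP; exact: measurable_funM.
  move=> x _; rewrite /= lee_fin !normrM ler_wpM2r// ger0_norm ?Gp0//.
  by rewrite /Gp ge_max ler_norm normr_ge0.
have iGmw : mu.-integrable setT (EFin \o (fun x => Gm x * box_weight i a b h x)).
  apply: (le_integrable _ _ _ iGw) => //.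
    by apply/measurable_EFinP; exact: measurable_funM.
  move=> x _; rewrite /= lee_fin !normrM ler_wpM2r// ger0_norm ?Gm0//.
  by rewrite /Gm ge_max -normrN ler_norm normr_ge0.
have EG : \int[mu]_x (G x * box_weight i a b h x) =
    \int[mu]_x (Gp x * box_weight i a b h x) - \int[mu]_x (Gm x * box_weight i a b h x).
  rewrite -RintegralB//; apply: eq_Rintegral => x _.
  rewrite -mulrBl; congr (_ * _); rewrite /Gp /Gm.
  by case: (leP (G x) 0) => ?; case: (leP (- G x) 0) => ?; lra.
have Efin (u : 'rV[R]_n -> R) : mu.-integrable setT (EFin \o u) ->
    (\int[mu]_x (u x)%:E)%E = (\int[mu]_x u x)%:E.
  by move=> iu; rewrite fineK//; exact: integrable_fin_num iu.
have I1 : (\int[mu]_(x in obox a b) (f x)%:E)%E = (\int[mu]_x (f x * \1_(obox a b) x))%:E.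
  rewrite -Efin// integral_mkcond epatch_indic.
  by apply: eq_integral => x _; rewrite EFinM.
have I2 : (\int[mu]_(x in obox a b) (fh x)%:E)%E =
    (\int[mu]_x (f x * \1_(obox a b) (x - h *: e_ i)))%:E.
  rewrite -Efin// integral_mkcond epatch_indic.
  rewrite -[RHS](integral_shift (h *: e_ i)).
  - by apply: eq_integral => x _; rewrite addrK EFinM.
  - by case/integrableP : ifh.
  - by move=> x; rewrite lee_fin mulr_ge0.
have J1 : (\int[mu]_(x in obox a b) slide i h Gp x)%E =
    (\int[mu]_x (Gp x * box_weight i a b h x))%:E.
  by rewrite integral_slide_obox// Efin.
have J2 : (\int[mu]_(x in obox a b) slide i h Gm x)%E =
    (\int[mu]_x (Gm x * box_weight i a b h x))%:E.
  by rewrite integral_slide_obox// Efin.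
have mB := @measurable_obox R n a b.
have D1 : (\int[mu]_(x in obox a b) F1 x)%E =
    (\int[mu]_x (f x * \1_(obox a b) x) + \int[mu]_x (Gp x * box_weight i a b h x))%:E.
  rewrite EFinD -I1 -J1 ge0_integralD//.
  - by move=> x _; rewrite lee_fin.
  - by apply/measurable_EFinP; exact: measurable_funTS.
  - by move=> x _; exact: slide_ge0.
  - by apply: measurable_funTS; exact: measurable_slide.
have D2 : (\int[mu]_(x in obox a b) F2 x)%E =
    (\int[mu]_x (f x * \1_(obox a b) (x - h *: e_ i)) +
     \int[mu]_x (Gm x * box_weight i a b h x))%:E.
  rewrite EFinD -I2 -J2 ge0_integralD//.
  - by move=> x _; rewrite lee_fin.
  - by apply/measurable_EFinP; exact: measurable_funTS.
  - by move=> x _; exact: slide_ge0.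
  - by apply: measurable_funTS; exact: measurable_slide.
rewrite D1 D2 ltry; split=> //; congr EFin.
by move: E; rewrite EG; lra.
Qed.

Let mF1 : measurable_fun setT F1.
Proof.
by apply: emeasurable_funD; [exact/measurable_EFinP|exact: measurable_slide].
Qed.
Let mF2 : measurable_fun setT F2.
Proof.
by apply: emeasurable_funD; [exact/measurable_EFinP|exact: measurable_slide].
Qed.

Let F10 x : (0 <= F1 x)%E.
Proof. by rewrite adde_ge0// ?lee_fin//; exact: slide_ge0. Qed.
Let F20 x : (0 <= F2 x)%E.
Proof. by rewrite adde_ge0// ?lee_fin//; exact: slide_ge0. Qed.

(** Boxes determine the measures with densities [F1] and [F2]; a box with some [b j < a j] is
    empty. *)
Lemma balance A : measurable A -> (\int[mu]_(x in A) F1 x = \int[mu]_(x in A) F2 x)%E.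
Proof.
apply: (eq_integral_obox mF1 F10 mF2 F20) => a b.
  have [/forallP ab|/forallPn[j]] := boolP [forall j, a j <= b j].
    by have [] := balance_obox ab.
  by rewrite -ltNge => /obox_unordered ->; rewrite !integral_set0.
have [/forallP ab|/forallPn[j]] := boolP [forall j, a j <= b j].
  by have [] := balance_obox ab.
by rewrite -ltNge => /obox_unordered ->; rewrite integral_set0.
Qed.

Let mslice (u : 'rV[R]_n -> R) x : measurable_fun setT u ->
  measurable_fun setT (fun t : measurableTypeR R =>
    (u (x + (t : R) *: e_ i) * \1_(`[0%R, h[%classic : set R) t)%:E).
Proof.
by move=> mu_; exact: (measurable_fun_pair2 x (measurable_slide_kernel i h mu_)).
Qed.

Let sqG x := G x ^+ 2.
Let sqG0 x : 0 <= sqG x. Proof. exact: sqr_ge0. Qed.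
Let msqG : measurable_fun setT sqG. Proof. exact: measurable_funX. Qed.

(* Young's inequality in place of Cauchy-Schwarz: [2 u <= (h / c) u^2 + c / h]. *)
Lemma slide_Gm_le c x : 0 < c ->
  (slide i h Gm x <= (h / (2 * c))%:E * slide i h sqG x + (c / 2)%:E)%E.
Proof.
move=> c0.
have hc0 : 0 < h / (2 * c) by rewrite divr_gt0// mulr_gt0.
have ch0 : 0 < c / (2 * h) by rewrite divr_gt0// mulr_gt0.
have mI : measurable_fun setT
    (fun t : measurableTypeR R => (\1_(`[0%R, h[%classic : set R) t : R)%:E).
  by apply/measurable_EFinP/measurable_indicP; exact: measurable_itv.
have -> : ((c / 2)%:E = (c / (2 * h))%:E *
    \int[@lebesgue_measure R]_t (\1_(`[0%R, h[%classic : set R) t)%:E)%E.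
  rewrite integral_indic// setIT.
  rewrite [X in (_ * X)%E](_ : _ = h%:E); last first.
    transitivity (@lebesgue_measure R (`[0%R, h[%classic : set R)) => //.
    by rewrite lebesgue_measure_itv/= lte_fin h0 sube0.
  by rewrite -EFinM; congr EFin; field; rewrite gt_eqF.
rewrite /slide -ge0_integralZl//; last 3 first.
- exact: mslice.
- by move=> t _; rewrite lee_fin mulr_ge0.
- by rewrite lee_fin ltW.
rewrite -ge0_integralZl//; last by rewrite lee_fin ltW.
rewrite -ge0_integralD//; last 4 first.
- by move=> t _; rewrite -EFinM lee_fin mulr_ge0 ?(ltW hc0)// mulr_ge0.
- by apply: measurable_funeM; exact: mslice.
- by move=> t _; rewrite -EFinM lee_fin mulr_ge0// ltW.
- by apply: measurable_funeM.
apply: ge0_le_integral => //.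
- by move=> t _; rewrite lee_fin mulr_ge0.
- exact: mslice.
- by apply: emeasurable_funD; apply: measurable_funeM => //; exact: mslice.
move=> t _; rewrite -!EFinM -EFinD lee_fin mulrA -mulrDl ler_wpM2r//.
have GmG : Gm (x + t *: e_ i) <= `|G (x + t *: e_ i)|.
  by rewrite /Gm ge_max -normrN ler_norm normr_ge0.
apply: (le_trans GmG); rewrite /sqG -real_normK ?num_real//.
set u := `|_|.
rewrite -(@ler_pM2r _ (2 * c * h)) ?mulr_gt0//.
rewrite (_ : (h / (2 * c) * u ^+ 2 + c / (2 * h)) * (2 * c * h) = (h * u) ^+ 2 + c ^+ 2).
  by rewrite -subr_ge0 (_ : _ - _ = (h * u - c) ^+ 2) ?sqr_ge0//; ring.
by field; rewrite !gt_eqF.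
Qed.

(** For the set [E] on the left, $c\,\mu(E) \le \int_E$ [slide i h Gm] $\le \frac{h^2}{2c}\int G^2 +
    \frac c2\mu(E)$. The box makes $\mu(E)$ finite, so the last term can be absorbed. *)
Lemma translate_obox c a b : 0 < c ->
  (mu (obox a b `&` [set x | (c <= f x - fh x)%R]) <=
   (h ^+ 2 / c ^+ 2)%:E * \int[mu]_x (sqG x)%:E)%E.
Proof.
move=> c0; set E := obox a b `&` _.
have mE : measurable E.
  apply: measurableI; first exact: measurable_obox.
  rewrite -[X in measurable X]setTI.
  apply: (measurable_fun_le (f := cst c) (g := fun x => f x - fh x)) => //.
  exact: measurable_funB.
have Ey : (mu E < +oo)%E.
  apply: le_lt_trans (@lebesgue_obox_lty R n a b).
  apply: le_measure; rewrite ?inE//; first exact: measurable_obox.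
  exact: subIsetl.
(* On [E] the translate [fh] lies below [f], which is integrable on the box. *)
have fhy : (\int[mu]_(x in E) (fh x)%:E < +oo)%E.
  apply: (@le_lt_trans _ _ (\int[mu]_(x in obox a b) (f x)%:E)%E).
    apply: (@le_trans _ _ (\int[mu]_(x in E) (f x)%:E)%E).
      apply: ge0_le_integral => //.
      - by move=> x _; rewrite lee_fin.
      - by apply/measurable_EFinP; exact: measurable_funTS.
      - by apply/measurable_EFinP; exact: measurable_funTS.
      by move=> x [_ /= cx]; rewrite lee_fin; lra.
    apply: ge0_subset_integral => //; first exact: measurable_obox.
    - by apply/measurable_EFinP; exact: measurable_funTS.
    - by move=> x _; rewrite lee_fin.
    exact: subIsetl.
  rewrite integral_mkcond epatch_indic.
  have /integrableP[_] := integrable_sqr_obox a b mf f2.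
  apply: le_lt_trans; apply: ge0_le_integral => //.
  - by move=> x _; rewrite -EFinM lee_fin mulr_ge0.
  - apply: emeasurable_funM; first exact/measurable_EFinP.
    by apply/measurable_EFinP/measurable_indicP; exact: measurable_obox.
  - apply/measurable_EFinP; apply: measurableT_comp => //; apply: measurable_funM => //.
    by apply/measurable_indicP; exact: measurable_obox.
  by move=> x _; rewrite /= -EFinM lee_fin ler_norm.
have sGm : (\int[mu]_(x in E) slide i h Gm x <=
    (h / (2 * c))%:E * (h%:E * \int[mu]_x (sqG x)%:E) + (c / 2)%:E * mu E)%E.
  apply: (@le_trans _ _ (\int[mu]_(x in E) ((h / (2 * c))%:E * slide i h sqG x + (c / 2)%:E))%E).
    apply: ge0_le_integral => //.
    - by move=> x _; exact: slide_ge0.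
    - by apply: measurable_funTS; exact: measurable_slide.
    - apply: measurable_funTS; apply: emeasurable_funD => //.
      by apply: measurable_funeM; apply: measurable_slide => // x; exact: sqr_ge0.
    by move=> x _; exact: slide_Gm_le.
  have hc0 : 0 <= h / (2 * c) by rewrite divr_ge0// ltW// mulr_gt0.
  have ms : measurable_fun setT (slide i h sqG).
    by apply: measurable_slide => // x; exact: sqr_ge0.
  rewrite ge0_integralD//; last 3 first.
  - by move=> x _; rewrite mule_ge0 ?lee_fin//; apply: slide_ge0 => y; exact: sqr_ge0.
  - by apply: measurable_funTS; exact: measurable_funeM.
  - by move=> x _; rewrite lee_fin divr_ge0// ltW.
  rewrite integral_cst//; apply: leeD => //.
  rewrite ge0_integralZl//; last 2 first.
  - by apply: measurable_funTS.
  - by move=> x _; apply: slide_ge0 => y; exact: sqr_ge0.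
  apply: lee_wpmul2l => //.
  rewrite -(integral_slideT i h0)//.
  apply: ge0_subset_integral => //.
  by move=> x _; apply: slide_ge0 => y; exact: sqr_ge0.
have lb : (c%:E * mu E <= \int[mu]_(x in E) slide i h Gm x)%E.
  apply: (le_integral_balance (u := f) (v := fh) (s := slide i h Gp) mE).
  - exact: measurable_funTS mf.
  - exact: measurable_funTS mfh.
  - by apply: measurable_funTS; exact: measurable_slide.
  - by apply: measurable_funTS; exact: measurable_slide.
  - exact: f0.
  - exact: fh0.
  - by move=> x; exact: slide_ge0.
  - by move=> x; exact: slide_ge0.
  - exact: ltW.
  - by move=> x [].
  - exact: fhy.
  exact: balance.
have {lb sGm} := le_trans lb sGm.
have Ef : mu E \is a fin_num by rewrite ge0_fin_numE.
have I2f : (\int[mu]_x (sqG x)%:E)%E \is a fin_num by exact: (integrable_fin_num _ G2).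
rewrite -(fineK Ef) -(fineK I2f) -!EFinM -EFinD !lee_fin.
set m := fine _; set I2 := fine _ => H.
rewrite -(@ler_pM2l _ (c / 2)) ?divr_gt0//.
suff -> : c / 2 * (h ^+ 2 / c ^+ 2 * I2) = h / (2 * c) * (h * I2) by lra.
by field; rewrite gt_eqF.
Qed.

(** The bound on a box does not depend on the box, so it survives exhaustion by cubes. *)
Lemma translate_estimate c : 0 < c ->
  (mu [set x | (c <= f x - f (x + h *: e_ i))%R] <=
   (h ^+ 2 / c ^+ 2)%:E * \int[mu]_x (G x ^+ 2)%:E)%E.
Proof.
move=> c0.
pose S := [set x | c <= f x - fh x].
have mS : measurable S.
  rewrite -[X in measurable X]setTI.
  apply: (measurable_fun_le (f := cst c) (g := fun x => f x - fh x)) => //.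
  exact: measurable_funB.
pose E (k : nat) := obox (fun=> - k%:R) (fun=> k%:R) `&` S.
have -> : [set x | c <= f x - f (x + h *: e_ i)] = \bigcup_k E k.
  by rewrite /E -setI_bigcupl obox_cover setTI.
have mE k : measurable (E k) by apply: measurableI => //; exact: measurable_obox.
have ndE : nondecreasing_seq E.
  move=> k l kl; apply/subsetPset => x [xk Sx]; split=> // j /=.
  have /= := xk j; rewrite !in_itv/=.
  have : k%:R <= l%:R :> R by rewrite ler_nat.
  by move=> kl' /andP[h1 h2]; apply/andP; split; lra.
have cE := @nondecreasing_cvg_mu _ _ _ mu E mE (bigcupT_measurable E mE) ndE.
rewrite -(cvg_lim _ cE)//; apply: lime_le; first by apply/cvg_ex; eexists; exact: cE.
by apply/nearW => k; exact: translate_obox.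
Qed.

End translate_estimate.

(** * Decay of the measure of superlevel sets *)


Lemma measure_bigsetU_le d (T : measurableType d) (R : realType) (mu : {measure set T -> \bar R})
    (I : eqType) (s : seq I) (A : I -> set T) : (forall i, measurable (A i)) ->
  (mu (\big[setU/set0]_(i <- s) A i) <= \sum_(i <- s) mu (A i))%E.
Proof.
move=> mA; elim: s => [|i s IHs]; first by rewrite !big_nil measure0.
rewrite !big_cons; apply: (@le_trans _ _ (mu (A i) + mu (\big[setU/set0]_(j <- s) A j))%E).
  by apply: measureU2 => //; exact: bigsetU_measurable.
exact: leeD.
Qed.

Lemma measurable_superlevel d (T : measurableType d) (R : realType) (g : T -> R) (c : R) :
  measurable_fun setT g -> measurable [set x | c <= g x] /\ measurable [set x | c < g x].
Proof.
move=> mg; split.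
  have := mg measurableT _ (measurable_itv `[c, +oo[); rewrite setTI; congr measurable.
  by apply/seteqP; split => x /=; rewrite in_itv/= andbT.
have := mg measurableT _ (measurable_itv `]c, +oo[); rewrite setTI; congr measurable.
by apply/seteqP; split => x /=; rewrite in_itv/= andbT.
Qed.

(** * Comparison of two superlevel sets by averaging over a cube *)

Section level.
Context (R : realType) (n : nat).
Local Notation mu := (@lebesgue_rV R n).
Local Notation e_ i := (delta_mx ord0 i : 'rV[R]_n).
Context (f : 'rV[R]_n -> R) (G : 'rV[R]_n -> 'rV[R]_n) (A2 : R).
Hypothesis mf : measurable_fun setT f.
Hypothesis f0 : forall x, 0 <= f x.
Hypothesis f2 : mu.-integrable setT (EFin \o (fun x => f x ^+ 2)).
Hypothesis mG : forall i, measurable_fun setT (fun x => G x ord0 i).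
Hypothesis G2 : forall i, mu.-integrable setT (EFin \o (fun x => G x ord0 i ^+ 2)).
Hypothesis wfG : forall i, measurably_weak_partial i f (fun x => G x ord0 i).
Hypothesis A2E : (\sum_(i < n) \int[mu]_x (G x ord0 i ^+ 2)%:E = A2%:E)%E.

Lemma A2_ge0 : 0 <= A2.
Proof.
rewrite -lee_fin -A2E; apply: sume_ge0 => i _; apply: integral_ge0 => x _.
by rewrite lee_fin sqr_ge0.
Qed.

(** The corners of the path from 0 to [y] that moves along one axis at a time. *)
Let head_part (y : 'rV[R]_n) (k : nat) : 'rV[R]_n :=
  \row_j (if (j < k)%N then y ord0 j else 0).

Let head_partS y (k : 'I_n) :
  head_part y k.+1 = head_part y k + y ord0 k *: e_ k.
Proof.
apply/rowP => j; rewrite !mxE eqxx /= ltnS.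
have [->|jk] := eqVneq j k; first by rewrite leqnn ltnn mulr1 add0r.
by rewrite mulr0 addr0 leq_eqVlt (inj_eq val_inj) (negbTE jk).
Qed.

Lemma measurable_level_diff (c : R) (z w : 'rV[R]_n) :
  measurable [set x : 'rV[R]_n | c <= f (x + z) - f (x + w)].
Proof.
apply: (measurable_superlevel _ _).1.
by apply: measurable_funB; exact: (measurableT_comp mf (measurable_shift _)).
Qed.

(** If [f] drops by at least [c] from [x] to [x + y], one of the [n] axis steps drops by at least
    [c / n], whence the factor $n^2$. Translation invariance reduces each step to
    [translate_estimate]. *)
Lemma translate_cube (h c : R) (y : 'rV[R]_n) : (0 < n)%N -> 0 < c ->
  (forall i, 0 < y ord0 i <= h) ->
  (mu [set x | (c <= f x - f (x + y))%R] <= (n%:R ^+ 2 * h ^+ 2 / c ^+ 2 * A2)%:E)%E.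
Proof.
move=> n0 c0 yh.
have nR : 0 < n%:R :> R by rewrite ltr0n.
pose S (k : 'I_n) := [set x | c / n%:R <= f (x + head_part y k) - f (x + head_part y k.+1)].
have mS k : measurable (S k) by exact: measurable_level_diff.
have mSk k : (mu (S k) <= (n%:R ^+ 2 * h ^+ 2 / c ^+ 2)%:E * \int[mu]_x (G x ord0 k ^+ 2)%:E)%E.
  pose S0 := [set x | c / n%:R <= f x - f (x + y ord0 k *: e_ k)].
  have mS0 : measurable S0.
    have := measurable_level_diff (c / n%:R) 0 (y ord0 k *: e_ k).
    by rewrite /S0; under eq_set do rewrite addr0.
  have -> : mu (S k) = mu S0.
    rewrite -(lebesgue_rV_shift (head_part y k) mS0); congr (mu _).
    by apply/seteqP; split => x; rewrite /S /S0 /= head_partS addrA.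
  have /andP[yk0 ykh] := yh k.
  apply: le_trans (translate_estimate mf f0 f2 (mG k) (G2 k) (@wfG k) yk0 _) _.
    by rewrite divr_gt0.
  apply: lee_wpmul2r.
    by apply: integral_ge0 => x _; rewrite lee_fin sqr_ge0.
  rewrite lee_fin expr_div_n invf_div mulrA ler_wpM2r ?invr_ge0 ?sqr_ge0//.
  rewrite mulrC ler_wpM2l ?sqr_ge0// ler_sqr ?nnegrE ?(ltW yk0)//.
  by rewrite (le_trans _ ykh)// ltW.
apply: (@le_trans _ _ (mu (\big[setU/set0]_(k <- index_enum 'I_n) S k))).
  apply: le_measure; rewrite ?inE.
  - have := measurable_level_diff c 0 y.
    by under eq_set do rewrite addr0.
  - by apply: bigsetU_measurable.
  move=> x /= cx; rewrite -bigcup_seq; apply: contrapT => nS.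
  have {}nS (k : 'I_n) : f (x + head_part y k) - f (x + head_part y k.+1) < c / n%:R.
    by rewrite ltNge; apply/negP => h1; apply: nS; exists k => //=; rewrite mem_index_enum.
  have hd0 : head_part y 0 = 0 by apply/rowP => j; rewrite !mxE.
  have T m : (m < n)%N -> f x - f (x + head_part y m.+1) < m.+1%:R * (c / n%:R).
    elim: m => [|m IHm] mn; have /= h1 := nS (Ordinal mn).
      by rewrite hd0 addr0 in h1; rewrite mul1r.
    by have := IHm (ltnW mn); rewrite -[in ltRHS]natr1 mulrDl mul1r; lra.
  have nn : (n.-1 < n)%N by rewrite prednK.
  have := T _ nn; rewrite prednK//.
  rewrite (_ : head_part y n = y); last by apply/rowP => j; rewrite !mxE ltn_ord.
  by rewrite mulrC divfK ?gt_eqF//; lra.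
apply: le_trans (measure_bigsetU_le _ _ mS) _.
rewrite EFinM -A2E ge0_sume_distrr; last first.
  by move=> k _; apply: integral_ge0 => x _; rewrite lee_fin sqr_ge0.
by apply: lee_sum => k _; exact: mSk.
Qed.

Lemma measurable_gt_level (s : R) : measurable [set x | s < f x].
Proof.
exact: (measurable_superlevel _ mf).2.
Qed.

Lemma lebesgue_cube (h : R) : 0 < h -> mu (obox (fun=> 0) (fun=> h)) = (h ^+ n)%:E.
Proof.
move=> h0; rewrite lebesgue_obox.
under eq_bigr do rewrite lebesgue_measure_itv/= lte_fin h0 sube0.
by rewrite prodEFin prodr_const card_ord.
Qed.

(** Double counting of the pairs $(x,y)$ with $f(x)>r$, $y$ in the cube and $f(x+y)\le s$. For fixed
    $y$, [translate_cube] bounds them from above; for fixed $x$ they fill at least the cube's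
    measure minus $|\{f>s\}|$. *)
Lemma level_estimate (s r h : R) : (0 < n)%N -> s < r -> 0 < h ->
  (mu [set x | (s < f x)%R] < +oo)%E ->
  fine (mu [set x | r < f x]) * (h ^+ n - fine (mu [set x | s < f x])) <=
  h ^+ n * (n%:R ^+ 2 * h ^+ 2 / (r - s) ^+ 2 * A2).
Proof.
move=> n0 sr h0 sy.
pose Er := [set x | r < f x]; pose Es := [set x | s < f x].
have mEr : measurable Er by exact: measurable_gt_level.
have mEs : measurable Es by exact: measurable_gt_level.
have Ersub : Er `<=` Es by move=> x /=; apply: lt_trans.
have Ery : (mu Er < +oo)%E.
  by apply: le_lt_trans sy; apply: le_measure; rewrite ?inE.
pose Q := obox (fun _ : 'I_n => 0) (fun=> h).
have mQ : measurable Q by exact: measurable_obox.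
pose F (z : 'rV[R]_n * 'rV[R]_n) : \bar R := (\1_Er z.1 * (\1_Q z.2 * \1_(~` Es) (z.1 + z.2)))%:E.
have m2 : measurable_fun setT (fun z : 'rV[R]_n * 'rV[R]_n => z.1 + z.2).
  apply: measurable_fun_rV => i; under eq_fun do rewrite mxE.
  apply: measurable_funD.
    exact: (measurableT_comp (measurable_rV_coord i) measurable_fst).
  exact: (measurableT_comp (measurable_rV_coord i) measurable_snd).
have mi (A : set 'rV[R]_n) : measurable A -> measurable_fun setT (\1_A : 'rV[R]_n -> R).
  by move=> mA; exact/measurable_indicP.
have mF : measurable_fun setT F.
  apply/measurable_EFinP; apply: measurable_funM.
    exact: (measurableT_comp (mi _ mEr) measurable_fst).
  apply: measurable_funM.
    exact: (measurableT_comp (mi _ mQ) measurable_snd).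
  exact: (measurableT_comp (mi _ (measurableC mEs)) m2).
have F0 z : (0 <= F z)%E by rewrite lee_fin !mulr_ge0.
have up : (\int[mu]_y \int[mu]_x F (x, y) <=
    (h ^+ n * (n%:R ^+ 2 * h ^+ 2 / (r - s) ^+ 2 * A2))%:E)%E.
  rewrite mulrC EFinM -(lebesgue_cube h0) -/Q.
  have <- : (\int[mu]_y ((n%:R ^+ 2 * h ^+ 2 / (r - s) ^+ 2 * A2)%:E * (\1_Q y)%:E) =
    (n%:R ^+ 2 * h ^+ 2 / (r - s) ^+ 2 * A2)%:E * mu Q)%E.
    rewrite ge0_integralZl//.
    - by rewrite integral_indic// setIT.
    - by apply/measurable_EFinP; exact: mi.
    - rewrite lee_fin mulr_ge0 ?A2_ge0// mulr_ge0 ?invr_ge0 ?sqr_ge0//.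
      by rewrite mulr_ge0 ?sqr_ge0.
  apply: ge0_le_integral => //.
  - by move=> y _; apply: integral_ge0.
  - by apply: (measurable_fun_fubini_tonelli_G (m1 := mu) F).
  - by apply: measurable_funeM; apply/measurable_EFinP; exact: mi.
  move=> y _.
  have [yQ|yQ] := pselect (Q y); last first.
    rewrite (_ : \1_Q y = 0) ?mule0; last by rewrite indicE memNset.
    rewrite integral0_eq// => x _; rewrite /F /=.
    by rewrite (_ : \1_Q y = 0) ?mul0r ?mulr0//; rewrite indicE memNset.
  rewrite (_ : \1_Q y = 1) ?mule1; last by rewrite indicE mem_set.
  have mD : measurable [set x | r - s <= f x - f (x + y)].
    by have := measurable_level_diff (r - s) 0 y; under eq_set do rewrite addr0.
  apply: (@le_trans _ _ (mu [set x | r - s <= f x - f (x + y)])); last first.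
    by apply: translate_cube => //; rewrite subr_gt0.
  set D := [set x | _] in mD *.
  have <- : (\int[mu]_x (\1_D x)%:E = mu D)%E by rewrite integral_indic// setIT.
  apply: ge0_le_integral => //.
  - exact: (measurable_fun_pair1 y mF).
  - by apply/measurable_EFinP; exact: mi.
  move=> x _; rewrite /F /= lee_fin !indicE.
  have [|] := boolP (x \in Er); last by rewrite mul0r.
  rewrite inE /Er /= => rx; rewrite mul1r.
  have [|] := boolP (x + y \in ~` Es); last by rewrite mulr0.
  rewrite inE /Es /= => /negP; rewrite -leNgt => sx.
  have -> : x \in D by rewrite inE /D /=; lra.
  by rewrite mulr1 ler_nat leq_b1.
have low : ((fine (mu Er) * (h ^+ n - fine (mu Es)))%:E <= \int[mu]_x \int[mu]_y F (x, y))%E.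
  (* If the cube is no larger than $\{f>s\}$, the left side is nonpositive. *)
  have [hs|hs] := leP (h ^+ n - fine (mu Es)) 0.
    apply: (@le_trans _ _ 0%E); first by rewrite lee_fin mulr_ge0_le0// fine_ge0.
    by apply: integral_ge0 => x _; exact: integral_ge0.
  rewrite mulrC EFinM fineK ?ge0_fin_numE//.
  have <- : (\int[mu]_x ((h ^+ n - fine (mu Es))%:E * (\1_Er x)%:E) =
      (h ^+ n - fine (mu Es))%:E * mu Er)%E.
    rewrite ge0_integralZl//.
    - by rewrite integral_indic// setIT.
    - by apply/measurable_EFinP; exact: mi.
    - by rewrite lee_fin ltW.
  apply: ge0_le_integral => //.
  - by move=> x _; rewrite -EFinM lee_fin mulr_ge0// ltW.
  - by apply: measurable_funeM; apply/measurable_EFinP; exact: mi.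
  - by apply: (measurable_fun_fubini_tonelli_F (m2 := mu) F).
  move=> x _.
  have [xE|xE] := pselect (Er x); last first.
    rewrite (_ : \1_Er x = 0) ?mule0; last by rewrite indicE memNset.
    exact: integral_ge0.
  rewrite (_ : \1_Er x = 1) ?mule1; last by rewrite indicE mem_set.
  pose W := Q `&` [set y | (~` Es) (x + y)].
  have mCs : measurable [set y | (~` Es) (x + y)].
    rewrite (_ : [set _ | _] = (fun y => y + x) @^-1` (~` Es)).
      rewrite -[X in measurable X]setTI; apply: measurable_shift => //; exact: measurableC.
    by apply/seteqP; split => y /=; rewrite addrC.
  have mW : measurable W by exact: measurableI.
  have -> : (\int[mu]_y F (x, y) = mu W)%E.
    have <- : (\int[mu]_y (\1_W y)%:E = mu W)%E by rewrite integral_indic// setIT.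
    apply: eq_integral => y _.
    rewrite /F /= (_ : \1_Er x = 1) ?mul1r; last by rewrite indicE mem_set.
    by rewrite /W indicI /=.
  (* A [y] in the cube either satisfies $f(x+y)\le s$ or lies in the translate of $\{f>s\}$ by $-x$,
     which has the same measure. *)
  have cov : (mu Q <= mu W + mu Es)%E.
    rewrite -(lebesgue_rV_shift x mEs).
    have mS : measurable ((fun y => y + x) @^-1` Es).
      by rewrite -[X in measurable X]setTI; apply: measurable_shift.
    apply: le_trans (measureU2 _ mW mS).
    apply: le_measure; rewrite ?inE//; first exact: measurableU.
    move=> y Qy; have [yE|yE] := pselect (Es (y + x)); first by right.
    by left; split => //=; rewrite addrC.
  rewrite lebesgue_cube// in cov.
  rewrite EFinB fineK ?ge0_fin_numE//.
  by rewrite leeBlDr// ge0_fin_numE.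
rewrite -lee_fin; apply: (le_trans low).
by rewrite (fubini_tonelli F mF F0).
Qed.

(** With $a = |\{f>s\}|$, the cube has measure $h^n = 2a$. Then $h^n/(h^n-a) = 2$ and $h^2 =
    (2a)^{2/n} \le 4a^{2/n}$, whence $8 = 2\cdot 4$. *)
Lemma level_decay (s r : R) : (0 < n)%N -> s < r ->
  (mu [set x | (s < f x)%R] < +oo)%E ->
  fine (mu [set x | r < f x]) <=
  8 * n%:R ^+ 2 * A2 / (r - s) ^+ 2 * fine (mu [set x | s < f x]) `^ (2 / n%:R).
Proof.
move=> n0 sr sy.
have rs : fine (mu [set x | r < f x]) <= fine (mu [set x | s < f x]).
  have h1 : (mu [set x | (r < f x)%R] <= mu [set x | (s < f x)%R])%E.
    apply: le_measure; rewrite ?inE; try exact: measurable_gt_level.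
    by move=> x /=; apply: lt_trans.
  by apply: fine_le => //; rewrite ge0_fin_numE//; apply: le_lt_trans sy.
set a := fine (mu [set x | s < f x]) in rs *.
have a0 : 0 <= a by exact: fine_ge0.
have rs0 : 0 < (r - s) ^+ 2 by rewrite exprn_gt0// subr_gt0.
(* A null $\{f>s\}$ would give a cube of size 0; in that case $\{f>r\}$ is null as well. *)
have [az|ap] := leP a 0.
  apply: (le_trans rs); apply: (le_trans az).
  rewrite mulr_ge0 ?powR_ge0// divr_ge0 ?sqr_ge0// !mulr_ge0 ?A2_ge0//.
have nR : 0 < n%:R :> R by rewrite ltr0n.
pose h := (2 * a) `^ (n%:R^-1).
have a20 : 0 < 2 * a by rewrite mulr_gt0.
have h0 : 0 < h by rewrite powR_gt0.
have hn : h ^+ n = 2 * a.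
  by rewrite -powR_mulrn ?(ltW h0)// -powRrM mulVf ?powRr1 ?(ltW a20)// gt_eqF.
have h2 : h ^+ 2 <= 4 * a `^ (2 / n%:R).
  rewrite -powR_mulrn ?(ltW h0)// -powRrM [n%:R^-1 * _]mulrC powRM// ler_wpM2r ?powR_ge0//.
  apply: (@le_trans _ _ (2 `^ 2)); last by rewrite powR_mulrn// -natrX.
  apply: ler_powR; first by rewrite ler1n.
  by rewrite ler_pdivrMr// ler_peMr// ler1n.
have := level_estimate n0 sr h0 sy.
rewrite -/a hn (_ : 2 * a - a = a); last by ring.
set b := fine _ => H.
have {}H : b <= 2 * (n%:R ^+ 2 * h ^+ 2 / (r - s) ^+ 2 * A2).
  rewrite -(@ler_pM2r _ a)//; apply: (le_trans H).
  by rewrite [leRHS]mulrAC.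
apply: (le_trans H).
have -> : 8 * n%:R ^+ 2 * A2 / (r - s) ^+ 2 * a `^ (2 / n%:R) =
  2 * (n%:R ^+ 2 * (4 * a `^ (2 / n%:R)) / (r - s) ^+ 2 * A2) by field; rewrite subr_eq0 gt_eqF.
rewrite ler_wpM2l// ler_wpM2r ?A2_ge0// ler_wpM2r ?invr_ge0 ?(ltW rs0)//.
by rewrite ler_wpM2l ?sqr_ge0.
Qed.

End level.

(** * Iteration over dyadic levels *)

Lemma powR_le (R : realType) (x y r : R) : 0 <= r -> 0 <= x -> x <= y -> x `^ r <= y `^ r.
Proof.
move=> r0 x0 xy; apply: ge0_ler_powR => //; rewrite nnegrE//.
exact: le_trans xy.
Qed.

Lemma powR_le1 (R : realType) (x r : R) : 0 <= x <= 1 -> 0 <= r -> x `^ r <= 1.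
Proof.
move=> /andP[x0 x1] r0; have := @ge0_ler_powR R r r0 x 1.
by rewrite powR1 !nnegrE; apply.
Qed.

(** As [c k <= 1], the exponent [nu] may be lowered to [theta]. Since $p\theta = p-2$, one has $-2k
    + \theta(p^2/2 - pk) = p^2/2 - p(k+1)$, so the bound reproduces itself. *)
Lemma sublinear_recursion_decay (R : realType) (c : nat -> R) (theta nu : R) :
  0 < theta < 1 -> theta <= nu ->
  (forall k, 0 <= c k) -> c 0 <= 1 ->
  (forall k, c k.+1 <= 4 ^- k * c k `^ nu) ->
  let p := 2 / (1 - theta) in
  forall k, c k <= 2 `^ (p ^+ 2 / 2) * 2 `^ (- (p * k%:R)).
Proof.
move=> /andP[t0 t1] tnu c0 c01 rec p.
have t1' : 0 < 1 - theta by rewrite subr_gt0.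
have p0 : 0 < p by rewrite divr_gt0.
have two k : (4 ^- k : R) = 2 `^ (- (2 * k%:R)).
  by rewrite powRN powRrM powR_mulrn ?powR_ge0// powR_mulrn// -[2 ^+ 2]natrX.
have c1 k : c k <= 1.
  elim: k => [//|k IHk]; apply: (le_trans (rec k)).
  rewrite mulr_ile1 ?powR_ge0 ?invr_ge0 ?exprn_ge0//.
    by rewrite invf_le1 ?exprn_gt0// exprn_ege1// ler1n.
  by rewrite powR_le1 ?c0// ltW// (lt_le_trans t0).
elim=> [|k IHk].
  rewrite mulr0 oppr0 powRr0 mulr1; apply: (le_trans c01).
  rewrite -[leLHS](@powRr0 _ 2); apply: ler_powR; first by rewrite ler1n.
  by rewrite divr_ge0 ?sqr_ge0.
have cnu : c k `^ nu <= c k `^ theta.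
  have [ck0|ck0] := leP (c k) 0.
    have -> : c k = 0 by apply/eqP; rewrite eq_le ck0 c0.
    by rewrite !powR0// gt_eqF// (lt_le_trans t0).
  by apply: ger_powR => //; rewrite ck0 c1.
apply: (le_trans (rec k)).
apply: (@le_trans _ _ (4 ^- k * (2 `^ (p ^+ 2 / 2) * 2 `^ (- (p * k%:R))) `^ theta)).
  rewrite ler_wpM2l ?invr_ge0 ?exprn_ge0//; apply: (le_trans cnu).
  apply: ge0_ler_powR; [exact: ltW|by rewrite nnegrE| |exact: IHk].
  by rewrite nnegrE mulr_ge0 ?powR_ge0.
rewrite two -!powRD; last 2 first.
- by rewrite pnatr_eq0 implybT.
- by rewrite pnatr_eq0 implybT.
rewrite -powRrM -powRD ?pnatr_eq0 ?implybT//.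
apply: ler_powR; first by rewrite ler1n.
rewrite -natr1.
have pE : p * theta = p - 2.
  have : p * (1 - theta) = 2 by rewrite /p divfK// gt_eqF.
  by rewrite mulrBr mulr1; lra.
have -> : (p ^+ 2 / 2 - p * k%:R) * theta = p / 2 * (p * theta) - (p * theta) * k%:R by field.
rewrite pE expr2 le_eqVlt; apply/orP; left; apply/eqP.
by field.
Qed.

(** For the least [k] with $f(x) \le 2^{k+1}\rho$, the point lies in the [k]-th level set, and the
    [k]-th term of the series alone is at least $f(x)^q$. The integrated series is geometric. *)
Lemma integral_dyadic_levels d (T : measurableType d) (R : realType)
    (mu : {measure set T -> \bar R}) (f : T -> R) (q rho z D : R) :
  measurable_fun setT f -> 0 < q -> 0 < rho -> 0 < z < 1 -> 0 <= D ->
  (forall k, ((2 ^+ k.+1 * rho) `^ q)%:E * mu [set x | (2 ^+ k * rho < f x)%R] <=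
    (D * z ^+ k)%:E)%E ->
  (\int[mu]_(x in [set x | (rho < f x)%R]) (f x `^ q)%:E <= (D / (1 - z))%:E)%E.
Proof.
move=> mf q0 r0 /andP[z0 z1] D0 H.
pose S k := [set x | (2 ^+ k * rho < f x)%R].
have mS k : measurable (S k) by exact: (measurable_superlevel _ mf).2.
have mSr : measurable [set x | rho < f x] by exact: (measurable_superlevel _ mf).2.
have mq : measurable_fun setT (fun x => f x `^ q).
  exact: (measurableT_comp (measurable_powR q) mf).
pose g k x : \bar R := (((2 ^+ k.+1 * rho) `^ q)%:E * (\1_(S k) x)%:E)%E.
have g0 k x : (0 <= g k x)%E by rewrite /g -EFinM lee_fin mulr_ge0// powR_ge0.
have mg k : measurable_fun setT (g k).
  by apply: measurable_funeM; apply/measurable_EFinP; exact/measurable_indicP.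
have pw x : rho < f x -> ((f x `^ q)%:E <= \sum_(0 <= k <oo) g k x)%E.
  move=> rx.
  have ex : exists k, f x <= 2 ^+ k.+1 * rho.
    exists (Num.truncn (f x / rho)); rewrite -ler_pdivrMr//.
    apply: (le_trans (ltW (truncnS_gt _))).
    rewrite -natrX ler_nat; set t := Num.truncn _.
    by apply: ltnW; exact: ltn_expl.
  case: (ex_minnP ex) => k fk kmin.
  have Skx : S k x.
    rewrite /S /=; case: k fk kmin => [|k] fk kmin; first by rewrite expr0 mul1r.
    by rewrite ltNge; apply/negP => h; have := kmin _ h; rewrite ltnn.
  apply: (@le_trans _ _ (g k x)).
    rewrite /g indicE mem_set// mule1 lee_fin.
    by apply: powR_le => //; apply: ltW => //; exact: lt_trans rx.
  apply: (@le_trans _ _ (\sum_(0 <= j < k.+1) g j x)%E).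
    by rewrite big_nat_recr//= leeDr// sume_ge0.
  by apply: nneseries_lim_ge => i _ _; exact: g0.
apply: (@le_trans _ _ (\int[mu]_x \sum_(0 <= k <oo) g k x)%E).
  rewrite integral_mkcond; apply: ge0_le_integral => //.
  - by move=> x _; rewrite patchE; case: ifPn => // _; rewrite lee_fin powR_ge0.
  - apply/(measurable_restrictT _ mSr)/measurable_funTS.
    exact/measurable_EFinP.
  - by apply: ge0_emeasurable_sum.
  move=> x _; rewrite patchE; case: ifPn => [|_]; first by rewrite inE => /pw.
  by apply: nneseries_ge0.
rewrite integral_nneseries//.
apply: lime_le; first by apply: is_cvg_nneseries => k _ _; exact: integral_ge0.
apply/nearW => N.
apply: (@le_trans _ _ (\sum_(0 <= k < N) (D * z ^+ k)%:E)%E).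
  apply: lee_sum => k _; rewrite /g ge0_integralZl//.
  - by rewrite integral_indic// setIT; exact: H.
  - by apply/measurable_EFinP/measurable_indicP.
  - by rewrite lee_fin powR_ge0.
rewrite sumEFin lee_fin.
apply: geometric_le_lim => //.
by rewrite ger0_norm// ltW.
Qed.

Section high_part.
Context (R : realType) (n : nat).
Local Notation mu := (@lebesgue_rV R n).

(** The measures of the levels $2^k\rho$, divided by [m], decay like $2^{-pk}$ with $p =
    2/(1-\theta) > q$. Against the growth $2^{qk}$ of $f^q$ this leaves the ratio $z = 2^{q-p} <
    1$. *)
Lemma high_part (q theta : R) : (0 < n)%N -> 0 < q -> 0 < theta < 1 ->
  theta <= 2 / n%:R -> q < 2 / (1 - theta) ->
  exists2 C : R, 0 < C &
  forall (f : 'rV[R]_n -> R) (A2 rho m : R), measurable_fun setT f ->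
    0 < rho -> 0 < m -> 8 * n%:R ^+ 2 * A2 * m `^ (2 / n%:R - 1) <= rho ^+ 2 ->
    (mu [set x | (rho < f x)%R] <= m%:E)%E ->
    (forall s r : R, s < r -> (mu [set x | (s < f x)%R] < +oo)%E ->
      fine (mu [set x | (r < f x)%R]) <=
        8 * n%:R ^+ 2 * A2 / (r - s) ^+ 2 * fine (mu [set x | (s < f x)%R]) `^ (2 / n%:R)) ->
  (\int[mu]_(x in [set x | (rho < f x)%R]) (f x `^ q)%:E <= (C * (rho `^ q * m))%:E)%E.
Proof.
move=> n0 q0 t01 tn qp.
have /andP[t0 t1] := t01.
set p := 2 / (1 - theta) in qp *.
pose z : R := 2 `^ (q - p).
have z0 : 0 < z by rewrite powR_gt0.
have z1 : z < 1.
  rewrite /z /powR pnatr_eq0/= -[ltRHS]expR0 ltr_expR pmulr_llt0 ?subr_lt0//.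
  by rewrite ln_gt0// ltr1n.
have z1' : 0 < 1 - z by rewrite subr_gt0.
pose P : R := 2 `^ (p ^+ 2 / 2).
have P0 : 0 < P by rewrite powR_gt0.
exists (2 `^ q * P / (1 - z)).
  by rewrite divr_gt0// mulr_gt0// powR_gt0.
move=> f A2 rho m mf r0 m0 Hrho Hm decay.
pose lv (k : nat) := [set x | (2 ^+ k * rho < f x)%R].
pose b k := fine (mu (lv k)).
have mlv k : measurable (lv k) by exact: (measurable_superlevel _ mf).2.
have lvm k : (mu (lv k) <= m%:E)%E.
  apply: le_trans Hm; apply: le_measure; rewrite ?inE//.
    exact: (measurable_superlevel _ mf).2.
  move=> x; rewrite /lv /=; apply: le_lt_trans.
  by rewrite ler_peMl ?(ltW r0)// exprn_ege1// ler1n.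
have lvy k : (mu (lv k) < +oo)%E by apply: (le_lt_trans (lvm k)); rewrite ltry.
have lvf k : mu (lv k) = (b k)%:E by rewrite /b fineK// ge0_fin_numE.
have b0 k : 0 <= b k by exact: fine_ge0.
pose c k := b k / m.
(* The gap $2^k\rho$ between consecutive levels produces $4^{-k}$; the lower bound on $\rho^2$ makes
   the remaining constant at most 1. *)
have crec k : c k.+1 <= 4 ^- k * c k `^ (2 / n%:R).
  have s_r : 2 ^+ k * rho < 2 ^+ k.+1 * rho.
    by rewrite ltr_pM2r// exprS ltr_pMl ?exprn_gt0// ltr1n.
  have := decay _ _ s_r (lvy k); rewrite -/(lv k) -/(lv k.+1) -/(b k) -/(b k.+1).
  have -> : 2 ^+ k.+1 * rho - 2 ^+ k * rho = 2 ^+ k * rho by rewrite exprS; ring.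
  move=> h1.
  rewrite /c ler_pdivrMr//; apply: (le_trans h1).
  have -> : b k `^ (2 / n%:R) = (b k / m) `^ (2 / n%:R) * m `^ (2 / n%:R).
    by rewrite -powRM ?divr_ge0// ?(ltW m0)// divfK ?gt_eqF.
  have -> : m `^ (2 / n%:R) = m * m `^ (2 / n%:R - 1).
    by rewrite mulr_powRB1 ?(ltW m0)// divr_gt0// ltr0n.
  have -> : (2 ^+ k * rho) ^+ 2 = 4 ^+ k * rho ^+ 2.
    by rewrite exprMn -exprM mulnC exprM -[2 ^+ 2]natrX.
  set X := (b k / m) `^ _; set Y := m `^ _ in Hrho *.
  have X0 : 0 <= X by exact: powR_ge0.
  have k4 : 0 < (4 ^+ k : R) by rewrite exprn_gt0.
  have r2 : 0 < rho ^+ 2 by rewrite exprn_gt0.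
  rewrite (_ : 8 * _ * _ / _ * _ =
    (8 * n%:R ^+ 2 * A2 * Y) / rho ^+ 2 * (4 ^- k * X * m)); last first.
    by field; rewrite !gt_eqF.
  rewrite ler_piMl// ?ler_pdivrMr ?mul1r//.
  by rewrite mulr_ge0 ?(ltW m0)// mulr_ge0// invr_ge0 ltW.
have cdec := @sublinear_recursion_decay _ c theta (2 / n%:R) t01 tn _ _ crec.
have {}cdec k : c k <= P * 2 `^ (- (p * k%:R)).
  apply: cdec => [j|]; first by rewrite divr_ge0// ltW.
  by rewrite /c ler_pdivrMr// mul1r -lee_fin -lvf.
rewrite (_ : 2 `^ q * P / (1 - z) * (rho `^ q * m) =
  (2 `^ q * P * (rho `^ q * m)) / (1 - z)); last by ring.
apply: integral_dyadic_levels => //; first by rewrite z0.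
  by rewrite !mulr_ge0 ?powR_ge0// ?(ltW m0)// ltW.
move=> k; apply: (@le_trans _ _ (((2 ^+ k.+1 * rho) `^ q)%:E * (b k)%:E)%E).
  by rewrite -(lvf k).
rewrite -EFinM lee_fin.
have bk : b k <= m * (P * 2 `^ (- (p * k%:R))).
  by have := cdec k; rewrite /c ler_pdivrMr// mulrC.
apply: (@le_trans _ _ ((2 ^+ k.+1 * rho) `^ q * (m * (P * 2 `^ (- (p * k%:R)))))).
  by rewrite ler_wpM2l// powR_ge0.
rewrite powRM ?exprn_ge0// ?(ltW r0)// exprS powRM// ?exprn_ge0//.
have -> : (2 ^+ k : R) `^ q = 2 `^ (q * k%:R) by rewrite -powR_mulrn// -powRrM mulrC.
have -> : z ^+ k = 2 `^ (q * k%:R) * 2 `^ (- (p * k%:R)).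
  rewrite -powRD ?pnatr_eq0 ?implybT// -powR_mulrn ?powR_ge0// -powRrM.
  by congr (_ `^ _); ring.
by rewrite le_eqVlt; apply/orP; left; apply/eqP; ring.
Qed.

End high_part.

(** * The function [L] and the final estimate *)


Section slowly_varying.
Context (R : realType) (L : R -> R).
Hypothesis Lpos : forall s : R, 0 < s -> 0 < L s.
Hypothesis Lmono : {in `[0, +oo[ &, {homo L : s t / s <= t}}.

(** For a fixed [la], passing from [s] to $t = s^{1+la}$ costs [L] at most the factor $B = 1 +
    a\,la$, while $t^\delta = s^{la\,\delta}s^\delta \le s^\delta/B$ for small [s]. So the bound at
    [s] implies the bound at [t], and iteration reaches every small [t]. *)
Lemma slow_growth_lower_bound (s0 a lambda0 delta : R) : 0 < s0 -> 0 < a -> 0 < lambda0 ->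
  (forall s lambda : R, s \in `]0, s0[ -> lambda \in `]0, lambda0[ ->
        L s <= (1 + a * lambda) * L (s `^ (1 + lambda))) ->
  0 < delta ->
  exists2 c : R, 0 < c & forall t : R, 0 < t <= 1 -> c * t `^ delta <= L t.
Proof.
move=> s00 a0 l0 Hl d0.
have mono s t : 0 <= s -> s <= t -> L s <= L t.
  by move=> s1 st; apply: Lmono => //; rewrite in_itv/= andbT// (le_trans s1).
pose la := lambda0 / 2.
have la0 : 0 < la by rewrite divr_gt0.
have laI : la \in `]0, lambda0[ by rewrite in_itv/= la0 /la; lra.
pose B := 1 + a * la.
have B0 : 0 < B by rewrite addr_gt0// mulr_gt0.
(* Below [s0] for the hypothesis, below 1 so that powers shrink, and small enough for
   $s^{la\,\delta}B \le 1$. *)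
pose s1 := Num.min (s0 / 2) (Num.min 2^-1 (B^-1 `^ (la * delta)^-1)).
have ld0 : 0 < la * delta by rewrite mulr_gt0.
have s1p : 0 < s1.
  by rewrite !lt_min divr_gt0//= invr_gt0 ltr0n/= powR_gt0// invr_gt0.
have s1s0 : s1 < s0 by apply: (@le_lt_trans _ _ (s0 / 2)); [rewrite ge_min lexx|lra].
have s1h : s1 <= 2^-1 by rewrite !ge_min lexx orbT.
have s11 : s1 < 1 by apply: (le_lt_trans s1h); lra.
have s1B s : 0 < s -> s <= s1 -> s `^ (la * delta) * B <= 1.
  move=> sp ss.
  rewrite -ler_pdivlMr// mul1r.
  have -> : B^-1 = (B^-1 `^ (la * delta)^-1) `^ (la * delta).
    by rewrite -powRrM mulVf ?powRr1 ?invr_ge0 ?(ltW B0)// gt_eqF.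
  apply: ge0_ler_powR; rewrite ?nnegrE ?powR_ge0 ?(ltW sp) ?(ltW ld0)//.
  by apply: (le_trans ss); rewrite !ge_min lexx !orbT.
(* The value at the left end of $[s_1^{1+la}, 1]$, where monotonicity alone gives the bound. *)
pose c := L (s1 `^ (1 + la)).
have cp : 0 < c by rewrite Lpos// powR_gt0.
have up t : 0 < t -> t <= s1 `^ (1 + la) ->
    c * (t `^ (1 + la)^-1) `^ delta <= L (t `^ (1 + la)^-1) ->
    c * t `^ delta <= L t.
  move=> tp ts; set s := t `^ _ => H.
  have sp : 0 < s by rewrite powR_gt0.
  have la1 : 0 < 1 + la by rewrite addr_gt0.
  have tE : t = s `^ (1 + la).
    by rewrite -powRrM mulVf ?powRr1 ?(ltW tp)// gt_eqF.
  have ss1 : s <= s1.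
    have -> : s1 = (s1 `^ (1 + la)) `^ (1 + la)^-1.
      by rewrite -powRrM mulfV ?powRr1 ?(ltW s1p)// gt_eqF.
    by apply: ge0_ler_powR => //; rewrite ?nnegrE ?powR_ge0 ?invr_ge0 ?ltW.
  have sI : s \in `]0, s0[ by rewrite in_itv/= sp (le_lt_trans ss1).
  have := Hl s la sI laI; rewrite -tE -/B => HL.
  have := s1B s sp ss1 => Hb.
  have -> : t `^ delta = s `^ (la * delta) * s `^ delta.
    rewrite tE -powRrM -powRD; last by rewrite (gt_eqF sp) implybT.
    by congr (_ `^ _); ring.
  rewrite mulrCA -(@ler_pM2l _ B)//; apply: le_trans HL; apply: le_trans H.
  have cs0 : 0 <= c * s `^ delta by rewrite mulr_ge0 ?powR_ge0// ltW.
  move: cs0; set Y := c * _ => Y0.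
  rewrite (_ : B * _ = s `^ (la * delta) * B * Y); last by rewrite /Y; ring.
  exact: ler_piMl.
have base t : s1 `^ (1 + la) <= t -> t <= 1 -> c * t `^ delta <= L t.
  move=> st t1.
  have t0 : 0 < t by apply: lt_le_trans st; rewrite powR_gt0.
  apply: (@le_trans _ _ c); last by apply: mono => //; exact: powR_ge0.
  rewrite ler_piMr ?(ltW cp)//.
  by rewrite powR_le1 ?(ltW d0) ?(ltW t0).
have ind k t : 0 < t <= 1 -> s1 `^ ((1 + la) ^+ k.+1) <= t -> c * t `^ delta <= L t.
  elim: k t => [|k IHk] t /andP[t0 t1] st; first by apply: base => //; rewrite expr1 in st.
  have la1 : 0 < 1 + la by rewrite addr_gt0.
  have [ts|ts] := leP t (s1 `^ (1 + la)); last by apply: base => //; exact: ltW.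
  apply: up => //; apply: IHk.
    rewrite powR_gt0//=.
    by rewrite powR_le1 ?invr_ge0 ?(ltW la1) ?(ltW t0).
  have -> : s1 `^ ((1 + la) ^+ k.+1) = (s1 `^ ((1 + la) ^+ k.+2)) `^ (1 + la)^-1.
    by rewrite -powRrM [(1 + la) ^+ k.+2]exprSr mulfK// gt_eqF.
  by apply: ge0_ler_powR; rewrite ?nnegrE ?invr_ge0 ?powR_ge0 ?(ltW la1) ?(ltW t0).
exists c => // t /andP[t0 t1].
have ln1 : ln s1 < 0 by rewrite ln_lt0// s1p s11.
(* By Bernoulli's inequality $(1+la)^{k+1} \ge \ln t/\ln s_1$, that is $s_1^{(1+la)^{k+1}} \le
   t$. *)
pose k := Num.truncn (ln t / ln s1 / la).
apply: (ind k); first by rewrite t0.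
rewrite -ler_ln ?posrE ?powR_gt0// ln_powR.
rewrite -ler_ndivrMr//.
have kb : ln t / ln s1 / la < k.+1%:R by exact: truncnS_gt.
have bern j : 1 + j%:R * la <= (1 + la) ^+ j.
  elim: j => [|j IHj]; first by rewrite mul0r addr0 expr0.
  rewrite exprS; apply: (@le_trans _ _ ((1 + la) * (1 + j%:R * la))).
    rewrite -natr1; have : 0 <= la * (j%:R * la) by rewrite !mulr_ge0// ltW.
    by lra.
  by rewrite ler_wpM2l// addr_ge0// ltW.
apply: le_trans (bern k.+1).
by move: kb; rewrite ltr_pdivrMr//; lra.
Qed.

End slowly_varying.

(** * Changes on null sets, the gradient norm and the exponents *)

Section null_modification.
Context d (T : measurableType d) (R : realType) (mu : {measure set T -> \bar R}).
Local Open Scope ereal_scope.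

(** The integral of a nonnegative function is a supremum over simple functions below it, hence
    monotone even without measurability. *)
Lemma ge0_le_integral_nonmeasurable (f g : T -> \bar R) :
  (forall x, 0 <= f x) -> (forall x, f x <= g x) ->
  \int[mu]_x f x <= \int[mu]_x g x.
Proof.
move=> f0 fg; have g0 x : 0 <= g x by apply: le_trans (fg x).
rewrite !ge0_integralTE//; apply: le_ereal_sup => _ [h hf <-].
by exists h => // x; apply: le_trans (hf x) (fg x).
Qed.

(** The function lies below $+\infty$ on [N] and 0 elsewhere, whose integral is $\infty\cdot 0 =
    0$. *)
Lemma integral_null_supp (N : set T) (f : T -> \bar R) : measurable N -> mu N = 0 ->
  (forall x, 0 <= f x) -> (forall x, ~ N x -> f x = 0) -> \int[mu]_x f x = 0.
Proof.
move=> mN N0 f0 fN; apply/eqP; rewrite eq_le integral_ge0// andbT.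
apply: (@le_trans _ _ (\int[mu]_x (cst +oo \_ N) x)).
  apply: ge0_le_integral_nonmeasurable => // x; rewrite patchE.
  case: ifPn => [_|]; first by rewrite leey.
  by rewrite notin_setE => /fN ->.
by rewrite -integral_mkcond integral_cst// N0 ?mul0e// mule0.
Qed.

(* [F] may fail to be measurable on [N]. *)
Lemma integral_ge_off_null (N : set T) (g F : T -> \bar R) : measurable N -> mu N = 0 ->
  measurable_fun setT g -> (forall x, 0 <= g x) -> (forall x, ~ N x -> F x = g x) ->
  \int[mu]_x g x <= \int[mu]_x F x.
Proof.
move=> mN N0 mg g0 Fg.
(* The negative part of [F] lives on the null set, so only the positive part counts. *)
rewrite (integralE _ _ F).
rewrite (@integral_null_supp N (F^\-)) ?sube0//; last first.
  by move=> x /Fg Fx; rewrite funenegE Fx; apply/max_idPr; rewrite leeNl oppe0.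
apply: (@le_trans _ _ (\int[mu]_x (g \_ (~` N)) x)).
  rewrite -integral_mkcond.
  by rewrite (ge0_negligible_integral mN measurableT)// setTD.
apply: ge0_le_integral_nonmeasurable => x; rewrite patchE; first by case: ifPn.
case: ifPn => [|_]; last exact: funepos_ge0.
by rewrite inE => Nx; rewrite funeposE (Fg _ Nx) le_max lexx.
Qed.

End null_modification.

(** Serves to replace a function by one that is nonnegative everywhere. The measurable derivative of
    [psi] keeps both products measurable, so equality almost everywhere suffices. *)
Lemma weak_partial_ae (R : realType) (n : nat) (i : 'I_n) (f g u : 'rV[R]_n -> R) :
  measurable_fun setT f -> measurable_fun setT g ->
  {ae lebesgue_rV R n, forall x, f x = g x} ->
  weak_partial i f u -> measurably_weak_partial i g u.
Proof.
move=> mf mg fg wf psi tpsi mpsi; rewrite -wf//; congr fine.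
apply: ae_eq_integral => //.
- by apply/measurable_EFinP; exact: measurable_funM.
- by apply/measurable_EFinP; exact: measurable_funM.
by apply: filterS fg => x /= -> _.
Qed.

(** Identifies the constant [A2] of the level estimates with the squared gradient norm, the squared
    Euclidean norm being the sum of the squared components. *)
Lemma gradL2_sqr (R : realType) (n : nat) (phi : 'rV[R]_n -> R) (A2 : R) :
  weak_L2_gradient phi (weak_grad phi) ->
  (\sum_(i < n) \int[lebesgue_rV R n]_x (weak_grad phi x ord0 i ^+ 2)%:E = A2%:E)%E ->
  0 <= gradL2 phi /\ gradL2 phi ^+ 2 = A2.
Proof.
move=> wG A2E.
have mG i : measurable_fun setT (fun x => weak_grad phi x ord0 i).
  by have [+ _] := wG i; move/sub_Lfun_mfun; rewrite inE.
have A20 : 0 <= A2.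
  rewrite -lee_fin -A2E; apply: sume_ge0 => i _; apply: integral_ge0 => x _.
  by rewrite lee_fin sqr_ge0.
have E : gradL2 phi = Num.sqrt A2.
  rewrite /gradL2 unlock /Lnorm.
  rewrite (_ : \int[_]_x _ = A2%:E)%E.
    by rewrite poweR_EFin /= powR12_sqrt.
  rewrite -A2E -ge0_integral_sum//.
  - apply: eq_integral => x _ /=.
    rewrite sumEFin.
    congr EFin.
    rewrite /euclidean_norm ger0_norm ?sqrtr_ge0// powR_mulrn ?sqrtr_ge0//.
    by rewrite sqr_sqrtr// sumr_ge0// => i _; exact: sqr_ge0.
  - by move=> i; apply/measurable_EFinP; exact: measurable_funX.
  - by move=> i x _; rewrite lee_fin sqr_ge0.
by rewrite E sqrtr_ge0 sqr_sqrtr.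
Qed.

(** For $n \le 2$, $2/n \ge 1$ leaves every $\theta < 1$ available, and $\theta = q/(q+2)$ gives
    $2/(1-\theta) = q+2$. For $n \ge 3$, $\theta = 2/n$ gives exactly $2n/(n-2)$. *)
Lemma subcritical_exponents (R : realType) (n : nat) (q : R) : (0 < n)%N -> 0 < q ->
  (q%:E < sobolev_exponent R n)%E ->
  0 < q^-1 - (n%:R - 2) / (2 * n%:R) /\
  exists theta : R, [/\ 0 < theta < 1, theta <= 2 / n%:R & q < 2 / (1 - theta)].
Proof.
move=> n0 q0; rewrite /sobolev_exponent.
have nR : 0 < n%:R :> R by rewrite ltr0n.
have qV : 0 < q^-1 by rewrite invr_gt0.
have n20 : 0 < 2 * n%:R :> R by rewrite mulr_gt0.
case: ifPn => [n2 _|].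
  have n2R : n%:R <= 2 :> R by rewrite (ler_nat _ n 2).
  split.
    have : (n%:R - 2) / (2 * n%:R) <= 0 :> R by rewrite pmulr_lle0 ?invr_gt0// subr_le0.
    by lra.
  have q2 : 0 < q + 2 by lra.
  exists (q / (q + 2)); split.
  - by rewrite divr_gt0//= ltr_pdivrMr//; lra.
  - apply: (@le_trans _ _ 1); first by rewrite ler_pdivrMr//; lra.
    by rewrite ler_pdivlMr// mul1r.
  rewrite (_ : 2 / _ = q + 2); first by lra.
  by field; rewrite gt_eqF//=; apply/eqP; lra.
rewrite -ltnNge => n2; rewrite lte_fin => qn.
have n2R : 2 < n%:R :> R by rewrite (ltr_nat _ 2 n).
have n2' : 0 < n%:R - 2 :> R by lra.
split.
  rewrite subr_gt0 -[X in X < _]invf_div ltf_pV2 ?posrE// divr_gt0//.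
exists (2 / n%:R); split => //.
- by rewrite divr_gt0//= ltr_pdivrMr// mul1r.
rewrite (_ : 2 / _ = 2 * n%:R / (n%:R - 2))//.
by field; rewrite !gt_eqF.
Qed.

(** * The bound for nonnegative functions, by ranges of values *)

Section main_estimate.
Context (R : realType) (n : nat) (L : R -> R) (Mb K q : R).
Local Notation mu := (@lebesgue_rV R n).
Hypothesis n0 : (0 < n)%N.
Hypothesis K0 : 0 < K.
Hypothesis q0 : 0 < q.
Hypothesis qsub : (q%:E < sobolev_exponent R n)%E.
Hypothesis Lpos : forall s, 0 < s -> 0 < L s.
Hypothesis L00 : 0 <= L 0.
Hypothesis Lmono : forall s t, 0 <= s -> s <= t -> L s <= L t.
Hypothesis Lb : forall s, 0 <= s -> L s <= Mb.
Hypothesis Lslow : forall delta : R, 0 < delta ->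
  exists2 c : R, 0 < c & forall t : R, 0 < t <= 1 -> c * t `^ delta <= L t.

Let beta : R := (n%:R - 2) / (2 * n%:R).
Let g : R := q * (q^-1 - beta).

Let Mb0 : 0 < Mb.
Proof. exact: lt_le_trans (Lpos ltr01) (Lb ler01). Qed.

(** This bound yields $t \le \rho$. For $\beta \le 0$ it follows from $L \le$ [Mb]; for $\beta > 0$
    the lower bound $c\,t^{1/(2\beta)}$ on $L(t)$ exactly balances $t^{1/2}$. *)
Lemma level_scale : exists2 Gam : R, 0 < Gam &
  forall t, 0 < t <= 1 -> t `^ 2^-1 * (K / L t) `^ beta <= Gam.
Proof.
have t1 t : 0 < t <= 1 -> t `^ 2^-1 <= 1.
  by move=> /andP[t0 t1]; rewrite powR_le1 ?(ltW t0).
have [b0|b0] := leP beta 0.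
  exists ((K / Mb) `^ beta); first by rewrite powR_gt0// divr_gt0.
  move=> t /[dup] /andP[t0 _] /t1 th.
  have Lt := Lpos t0.
  apply: (@le_trans _ _ (1 * (K / L t) `^ beta)); first by rewrite ler_wpM2r ?powR_ge0.
  rewrite mul1r -[beta]opprK powRN [leRHS]powRN lef_pV2 ?posrE ?powR_gt0 ?divr_gt0//.
  apply: powR_le; [by rewrite oppr_ge0|by rewrite divr_ge0// ltW|].
  by rewrite ler_wpM2l ?(ltW K0)// lef_pV2 ?posrE// Lb// ltW.
have d0 : 0 < (2 * beta)^-1 by rewrite invr_gt0 mulr_gt0.
have [c c0 Hc] := Lslow d0.
exists ((K / c) `^ beta); first by rewrite powR_gt0// divr_gt0.
move=> t t01; have /andP[t0 _] := t01.
have Lt := Lpos t0.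
have tp : 0 < t `^ (2 * beta)^-1 by rewrite powR_gt0.
apply: (@le_trans _ _ (t `^ 2^-1 * (K / (c * t `^ (2 * beta)^-1)) `^ beta)).
  rewrite ler_wpM2l ?powR_ge0//.
  apply: powR_le; [exact: ltW|by rewrite divr_ge0// ltW|].
  by rewrite ler_wpM2l ?(ltW K0)// lef_pV2 ?posrE ?mulr_gt0// Hc.
rewrite invfM mulrA powRM ?divr_ge0 ?invr_ge0 ?(ltW K0) ?(ltW c0) ?(ltW tp)//.
rewrite -[(t `^ _)^-1]powRN -powRrM mulrCA -powRD; last by rewrite (gt_eqF t0) implybT.
rewrite (_ : 2^-1 + _ = 0) ?powRr0 ?mulr1//.
by field; rewrite gt_eqF.
Qed.

(** Chebyshev's inequality: by monotonicity $L(f) \ge L(t)$ where $f > t$. *)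
Lemma superlevel_le (f : 'rV[R]_n -> R) (t : R) : measurable_fun setT f ->
  measurable_fun setT (L \o f) -> (forall x, 0 <= f x) ->
  (\int[mu]_x (L (f x))%:E <= K%:E)%E -> 0 < t ->
  (mu [set x | (t < f x)%R] <= (K / L t)%:E)%E.
Proof.
move=> mf mLf f0 HK t0.
have Lt := Lpos t0.
have mS : measurable [set x | t < f x] by exact: (measurable_superlevel _ mf).2.
suff H : ((L t)%:E * mu [set x | (t < f x)%R] <= K%:E)%E.
  rewrite -(@lee_pmul2l _ (L t)%:E) ?fin_numE ?lte_fin//.
  by rewrite -EFinM mulrCA mulfV ?mulr1 ?gt_eqF.
apply: le_trans HK; rewrite -integral_cst//.
rewrite integral_mkcond; apply: ge0_le_integral => //.
- by move=> x _; rewrite patchE; case: ifPn => // _; rewrite lee_fin ltW.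
- apply/(measurable_restrictT _ mS); exact: measurable_cst.
- exact/measurable_EFinP.
move=> x _; rewrite patchE; case: ifPn => [|_].
  by rewrite inE /= => tx; rewrite lee_fin Lmono// ltW.
by rewrite lee_fin; apply: le_trans L00 (Lmono _ _).
Qed.

Lemma main_estimate : exists2 C : R, 0 < C &
  forall (f : 'rV[R]_n -> R) (A : R), measurable_fun setT f ->
    measurable_fun setT (L \o f) -> (forall x, 0 <= f x) -> 0 < A ->
    (\int[mu]_x (L (f x))%:E <= K%:E)%E ->
    (forall s r : R, s < r -> (mu [set x | (s < f x)%R] < +oo)%E ->
      fine (mu [set x | (r < f x)%R]) <=
        8 * n%:R ^+ 2 * A ^+ 2 / (r - s) ^+ 2 * fine (mu [set x | (s < f x)%R]) `^ (2 / n%:R)) ->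
  (\int[mu]_x (f x `^ q)%:E <= (C * (A `^ q * L (A ^+ 2) `^ (- g)))%:E)%E.
Proof.
have [gam0 [theta [t01 tn tq]]] := subcritical_exponents n0 q0 qsub.
have g0 : 0 < g by rewrite mulr_gt0.
have [C1 C10 HC1] := @high_part R n q theta n0 q0 t01 tn tq.
have [Gam0 Gam00 HGam] := level_scale.
have q20 : 0 < q / 2 by rewrite divr_gt0.
have [c c0 Hc] := Lslow q20.
have L1 := Lpos ltr01.
have nR : 0 < n%:R :> R by rewrite ltr0n.
(* [Gam0] serves for $t \le \rho$, and $3n$ for $8n^2 \le$ [Gam ^+ 2], which [high_part]
   requires. *)
pose Gam : R := Gam0 + 3 * n%:R.
have Gamp : 0 < Gam by rewrite addr_gt0// mulr_gt0.
exists (K / c * Mb `^ g + (1 + C1) * (Gam `^ q * (K * Mb / L 1) `^ g)).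
  apply: addr_gt0; first by rewrite mulr_gt0 ?powR_gt0// divr_gt0.
  apply: mulr_gt0; first by rewrite addr_gt0.
  by rewrite mulr_gt0 ?powR_gt0// divr_gt0// mulr_gt0.
move=> f A mf mLf f0 A0 HK decay.
have A20 : 0 < A ^+ 2 by rewrite exprn_gt0.
(* The cut at 1 keeps [t] where the lower bounds on [L] hold; [Ltlow] later returns from $L(t)$ to
   $L(A^2)$. *)
pose t := Num.min (A ^+ 2) 1.
have t0 : 0 < t by rewrite lt_min A20 ltr01.
have t1 : t <= 1 by rewrite ge_min lexx orbT.
have tA : t <= A ^+ 2 by rewrite ge_min lexx.
have tI : 0 < t <= 1 by rewrite t0.
have Lt := Lpos t0.
have LA := Lpos A20.
pose m := K / L t.
have m0 : 0 < m by rewrite divr_gt0.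
pose rho := Gam * A * m `^ (- beta).
have rho0 : 0 < rho by rewrite !mulr_gt0// powR_gt0.
have sqA : t `^ 2^-1 <= A.
  rewrite powR12_sqrt ?(ltW t0)// -[leRHS]ger0_norm ?(ltW A0)// -sqrtr_sqr.
  by rewrite ler_wsqrtr.
have trho : t <= rho.
  have -> : t = t `^ 2^-1 * t `^ 2^-1.
    rewrite -powRD; last by rewrite (gt_eqF t0) implybT.
    by rewrite -[in LHS](powRr1 (ltW t0)); congr (_ `^ _); lra.
  rewrite /rho [Gam * A]mulrC -mulrA; apply: ler_pM; rewrite ?powR_ge0//.
  rewrite powRN ler_pdivlMr ?powR_gt0//.
  by apply: (le_trans (HGam _ tI)); rewrite lerDl mulr_ge0.
have Hrho : 8 * n%:R ^+ 2 * A ^+ 2 * m `^ (2 / n%:R - 1) <= rho ^+ 2.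
  have -> : rho ^+ 2 = Gam ^+ 2 * A ^+ 2 * m `^ (2 / n%:R - 1).
    rewrite /rho !exprMn; congr (_ * _).
    rewrite -powR_mulrn ?powR_ge0// -powRrM; congr (_ `^ _).
    by rewrite /beta; field; rewrite gt_eqF.
  rewrite ler_wpM2r ?powR_ge0// ler_wpM2r ?(ltW A20)//.
  apply: (@le_trans _ _ ((3 * n%:R) ^+ 2)).
    by rewrite exprMn ler_wpM2r ?sqr_ge0//; lra.
  by rewrite ler_sqr ?nnegrE ?(ltW Gamp) ?mulr_ge0// lerDr ltW.
have levt : (mu [set x | (t < f x)%R] <= m%:E)%E by exact: superlevel_le.
have mSt : measurable [set x | t < f x] by exact: (measurable_superlevel _ mf).2.
have mSr : measurable [set x | rho < f x] by exact: (measurable_superlevel _ mf).2.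
have levr : (mu [set x | (rho < f x)%R] <= m%:E)%E.
  apply: le_trans levt; apply: le_measure; rewrite ?inE//.
  by move=> x /=; apply: le_lt_trans.
have high := HC1 f (A ^+ 2) rho m mf rho0 m0 Hrho levr decay.
have mq : measurable_fun setT (fun x => f x `^ q).
  exact: (measurableT_comp (measurable_powR q) mf).
pose St := [set x | t < f x]; pose Sr := [set x | rho < f x].
pose fq x := (f x `^ q)%:E.
have mqr : measurable_fun setT (fq \_ Sr).
  apply/(measurable_restrictT _ mSr)/measurable_funTS; exact/measurable_EFinP.
have mi : measurable_fun setT (fun x => (\1_St x : R)%:E).
  by apply/measurable_EFinP/measurable_indicP.
have Lf0 x : 0 <= L (f x) by apply: le_trans L00 (Lmono _ _).
have tqc0 : 0 <= t `^ (q / 2) / c by rewrite divr_ge0 ?powR_ge0// ltW.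
have total : (\int[mu]_x (f x `^ q)%:E <=
    (t `^ (q / 2) / c * K + rho `^ q * m + C1 * (rho `^ q * m))%:E)%E.
  (* The three terms majorize $f^q$ on $f \le t$, on $t < f \le \rho$ and on $f > \rho$
     respectively. *)
  apply: (@le_trans _ _ (\int[mu]_x ((t `^ (q / 2) / c)%:E * (L (f x))%:E +
      (rho `^ q)%:E * (\1_St x)%:E + (fq \_ Sr) x))%E).
    apply: ge0_le_integral => //.
    - by move=> x _; rewrite lee_fin powR_ge0.
    - exact/measurable_EFinP.
    - apply: emeasurable_funD => //; apply: emeasurable_funD; apply: measurable_funeM => //.
      exact/measurable_EFinP.
    move=> x _; rewrite patchE indicE -!EFinM -EFinD.
    have tl0 : 0 <= t `^ (q / 2) / c * L (f x) by rewrite mulr_ge0.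
    have r0 : 0 <= rho `^ q by exact: powR_ge0.
    have [rx|xr] := ltP rho (f x).
      have -> : x \in Sr by rewrite inE.
      by rewrite /fq -EFinD lee_fin lerDr addr_ge0// mulr_ge0.
    have -> : (x \in Sr) = false by apply/negbTE; rewrite notin_setE /Sr /= ltNge xr.
    rewrite adde0 lee_fin.
    have [tx|xt] := ltP t (f x).
      have -> : x \in St by rewrite inE.
      rewrite mulr1 -[leLHS]add0r lerD//.
      by apply: powR_le => //; exact: ltW.
    have -> : (x \in St) = false by apply/negbTE; rewrite notin_setE /St /= ltNge xt.
    rewrite mulr0 addr0.
    have [fx0|fx0] := leP (f x) 0.
      have -> : f x = 0 by apply/eqP; rewrite eq_le fx0 f0.
      by rewrite powR0 ?gt_eqF// mulr_ge0.
    (* One half power is at most $t^{q/2}$; the other is at most $L(f)/c$. *)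
    rewrite (_ : f x `^ q = f x `^ (q / 2) * f x `^ (q / 2)); last first.
      rewrite -powRD; last by rewrite (gt_eqF fx0) implybT.
      by congr (_ `^ _); lra.
    rewrite -mulrA; apply: ler_pM; rewrite ?powR_ge0//.
      by apply: powR_le => //; exact: ltW.
    by rewrite ler_pdivlMl// Hc// fx0 (le_trans xt).
  rewrite ge0_integralD//; last 3 first.
  - by move=> x _; rewrite adde_ge0// mule_ge0// lee_fin// powR_ge0.
  - by apply: emeasurable_funD; apply: measurable_funeM => //; exact/measurable_EFinP.
  - by move=> x _; rewrite patchE; case: ifPn => // _; rewrite lee_fin powR_ge0.
  rewrite [in leRHS]EFinD; apply: leeD; last by rewrite -integral_mkcond.
  rewrite ge0_integralD//; last 4 first.
  - by move=> x _; rewrite mule_ge0// lee_fin.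
  - by apply: measurable_funeM; exact/measurable_EFinP.
  - by move=> x _; rewrite mule_ge0// lee_fin// powR_ge0.
  - exact: measurable_funeM.
  rewrite EFinD; apply: leeD.
    rewrite ge0_integralZl//; last 2 first.
    - exact/measurable_EFinP.
    - by move=> x _; rewrite lee_fin.
    by rewrite [leRHS]EFinM; apply: lee_wpmul2l => //; rewrite lee_fin.
  rewrite ge0_integralZl//; last by rewrite lee_fin powR_ge0.
  rewrite integral_indic// setIT [leRHS]EFinM.
  by apply: lee_wpmul2l => //; rewrite lee_fin powR_ge0.
apply: (le_trans total); rewrite lee_fin.
have tqA : t `^ (q / 2) <= A `^ q.
  have -> : A `^ q = (A ^+ 2) `^ (q / 2).
    by rewrite -powR_mulrn ?(ltW A0)// -powRrM; congr (_ `^ _); lra.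
  by apply: powR_le => //; exact: ltW.
set Lam := L (A ^+ 2) in LA *.
(* The low range carries no power of [L]; this factor, at least 1, supplies $L(A^2)^{-g}$. *)
have one_le : 1 <= Mb `^ g * Lam `^ (- g).
  rewrite powRN ler_pdivlMr ?powR_gt0// mul1r.
  by apply: powR_le; [exact: ltW|exact: ltW|apply: Lb; exact: ltW].
(* The powers of [m] add up to $1 - q\beta = g$. *)
have rhoE : rho `^ q * m = Gam `^ q * A `^ q * m `^ g.
  have GA0 : 0 <= Gam * A by rewrite mulr_ge0// ltW.
  rewrite /rho (powRM _ GA0) ?powR_ge0// (powRM _ (ltW Gamp) (ltW A0)).
  rewrite -[X in _ * X = _](powRr1 (ltW m0)) -!mulrA; congr (_ * (_ * _)).
  rewrite -powRrM -powRD; last by rewrite (gt_eqF m0) implybT.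
  by congr (_ `^ _); rewrite /g; field; rewrite gt_eqF.
(* Either $t = A^2$ and $L(1) \le$ [Mb], or $t = 1$ and $L(A^2) \le$ [Mb]. *)
have Ltlow : Lam <= Mb / L 1 * L t.
  rewrite mulrAC ler_pdivlMr// /t; case: (leP (A ^+ 2) 1) => hA.
    by rewrite mulrC ler_wpM2r ?(ltW LA)// Lb.
  by rewrite ler_wpM2r ?(ltW L1)// Lb// ltW.
have mle : m `^ g <= (K * Mb / L 1) `^ g * Lam `^ (- g).
  rewrite powRN ler_pdivlMr ?powR_gt0// -powRM ?(ltW m0) ?(ltW LA)//.
  apply: powR_le; [exact: ltW|by rewrite mulr_ge0// ltW|].
  rewrite /m -mulrA -[X in _ <= X]mulrA ler_wpM2l ?(ltW K0)//.
  by rewrite ler_pdivrMl// mulrC.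
set Y := Lam `^ (- g) in one_le mle *.
have Y0 : 0 <= Y by exact: powR_ge0.
have Aq0 : 0 <= A `^ q by exact: powR_ge0.
rewrite -addrA -[X in _ + (X + _)]mul1r -mulrDl rhoE.
rewrite [leRHS]mulrDl; apply: lerD.
  rewrite (_ : K / c * Mb `^ g * (A `^ q * Y) = A `^ q / c * K * (Mb `^ g * Y)); last by ring.
  apply: (@le_trans _ _ (A `^ q / c * K)).
    by rewrite ler_wpM2r ?(ltW K0)// ler_wpM2r// invr_ge0 ltW.
  by rewrite ler_peMr// mulr_ge0 ?(ltW K0)// divr_ge0// ltW.
rewrite -[leRHS]mulrA; apply: ler_wpM2l; first by rewrite addr_ge0// ltW.
rewrite (_ : Gam `^ q * _ * (A `^ q * Y) =
  Gam `^ q * A `^ q * ((K * Mb / L 1) `^ g * Y)); last by ring.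
by rewrite ler_wpM2l// mulr_ge0// powR_ge0.
Qed.

End main_estimate.

(** * Passage from the Sobolev function to its absolute value *)

Unset Implicit Arguments.

Theorem theorem1p1 (R : realType) (n : nat) (hn : (1 <= n)%N)
    (s0 : R) (hs0 : 0 < s0) (L : R -> R)
    (hLC0 : {within `[0, +oo[, continuous L})
    (hLder : forall s : R, s \in `]0, s0[ -> derivable L s 1)
    (hLC1 : {within `]0, s0[, continuous L^`()%classic})
    (hLpos : forall s : R, 0 < s -> 0 < L s)
    (hLbnd : [bounded L s | s in `[0, +oo[])
    (hLmono : {in `[0, +oo[ &, {homo L : s t / s <= t}})
    (hLlam : exists a lambda0 : R, [/\ 0 < a, 0 < lambda0 &
      forall s lambda : R, s \in `]0, s0[ -> lambda \in `]0, lambda0[ ->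
        L s <= (1 + a * lambda) * L (s `^ (1 + lambda))]) :
  forall K q : R, 0 < K -> 0 < q -> (q%:E < sobolev_exponent R n)%E ->
  exists2 C : R, 0 < C &
    forall phi : 'rV[R]_n -> R,
      W12 phi ->
      {ae lebesgue_rV R n, forall x, 0 <= phi x} ->
      ~ {ae lebesgue_rV R n, forall x, phi x = 0} ->
      (\int[lebesgue_rV R n]_x (L (phi x))%:E <= K%:E)%E ->
      ('N[lebesgue_rV R n]_q%:E[EFin \o phi] <=
        (C * gradL2 phi *
          L (gradL2 phi ^+ 2) `^ (- (q^-1 - (n%:R - 2) / (2 * n%:R))))%:E)%E.
Proof.
move=> K q K0 q0 qsub.
have Lmono s t : 0 <= s -> s <= t -> L s <= L t.
  by move=> s_ge0 st; apply: hLmono => //; rewrite in_itv/= andbT// (le_trans s_ge0).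
(* [L] is right-continuous at 0 and positive to the right of it. *)
have L00 : 0 <= L 0.
  have [_ Lr] := (continuous_within_itvcyP 0 L).1 hLC0.
  rewrite -(cvg_lim _ Lr)//; apply: limr_ge; first by apply/cvg_ex; eexists; exact: Lr.
  near=> s; apply/ltW/hLpos; near: s; exact: nbhs_right_gt.
have [Mb HMb] : exists Mb, forall s, 0 <= s -> L s <= Mb.
  have [M [_ HM]] := hLbnd; exists (M + 1) => s s_ge0.
  apply: le_trans (ler_norm _) _; apply: (HM (M + 1)); first by rewrite ltrDl.
  by rewrite /= in_itv/= s_ge0.
have [a [lambda0 [a0 lambda00 HL]]] := hLlam.
have Lslow (delta : R) : 0 < delta ->
    exists2 c : R, 0 < c & forall t : R, 0 < t <= 1 -> c * t `^ delta <= L t.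
  exact: (slow_growth_lower_bound hLpos hLmono hs0 a0 lambda00 HL).
have [C C0 HC] := main_estimate hn K0 q0 qsub hLpos L00 Lmono HMb Lslow.
(* [main_estimate] bounds the [q]-th power of the norm. *)
exists (C `^ q^-1); first exact: powR_gt0.
move=> phi [phi2 [G0 wG0]] phi_ge0 phi_neq0 HK.
set mu := lebesgue_rV R n.
have wG : weak_L2_gradient phi (weak_grad phi).
  exact: (@xgetPex _ (fun=> 0) (weak_L2_gradient phi) (ex_intro _ G0 wG0)).
have mphi : measurable_fun setT phi by move/sub_Lfun_mfun: phi2; rewrite inE.
(* [phi] is nonnegative only almost everywhere; [f] is so everywhere and agrees with [phi] off a
   null set. *)
pose f x := `|phi x|.
have f_ge0 x : 0 <= f x by exact: normr_ge0.
have mf : measurable_fun setT f by exact: measurableT_comp.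
have f2 : mu.-integrable setT (EFin \o (fun x => f x ^+ 2)).
  have := Lfun2_integrable_sqr phi2; congr (integrable _ _ _).
  by apply/funext => x /=; rewrite /f real_normK// num_real.
have phif : {ae mu, forall x, phi x = f x}.
  by apply: filterS phi_ge0 => x /= phix; rewrite /f ger0_norm.
have mG i : measurable_fun setT (fun x => weak_grad phi x ord0 i).
  by have [/sub_Lfun_mfun] := wG i; rewrite inE.
have G2 i : mu.-integrable setT (EFin \o (fun x => weak_grad phi x ord0 i ^+ 2)).
  by have [/Lfun2_integrable_sqr] := wG i.
have wfG i : measurably_weak_partial i f (fun x => weak_grad phi x ord0 i).
  by apply: (weak_partial_ae mphi mf phif); case: (wG i).
pose A2 := \sum_(i < n) fine (\int[mu]_x (weak_grad phi x ord0 i ^+ 2)%:E)%E.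
have A2E : (\sum_(i < n) \int[mu]_x (weak_grad phi x ord0 i ^+ 2)%:E = A2%:E)%E.
  rewrite /A2 -sumEFin; apply: eq_bigr => i _; rewrite fineK//.
  exact: (integrable_fin_num _ (G2 i)).
have [A_ge0 AE] := gradL2_sqr wG A2E.
have decay := level_decay mf f_ge0 f2 mG G2 wfG A2E.
rewrite -AE in decay.
set A := gradL2 phi in A_ge0 AE decay *.
have mL : measurable_fun (`[0, +oo[%classic : set R) L.
  exact: subspace_continuous_measurable_fun.
(* [L] is known to be measurable only on $[0,\infty)$, where [f] takes its values. *)
have mLf : measurable_fun setT (L \o f).
  apply: (measurable_comp _ _ mL mf); first exact: measurable_itv.
  by move=> _ [x _ <-] /=; rewrite in_itv/= f_ge0.
(* On the null set where [phi] is negative, [L (phi x)] is arbitrary and may fail to be measurable,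
   so the integrals are compared off that set. *)
have HKf : (\int[mu]_x (L (f x))%:E <= K%:E)%E.
  pose N := [set x | phi x < 0].
  have mN : measurable N.
    have := measurableC (measurable_superlevel 0 mphi).1; congr measurable.
    by apply/seteqP; split => x; rewrite /N /= ltNge => /negP.
  apply: le_trans HK; apply: (integral_ge_off_null mN).
  - apply/negligibleP => //; apply: negligibleS phi_ge0 => x /=.
    by rewrite /N /= ltNge => /negP.
  - exact/measurable_EFinP.
  - by move=> x; rewrite lee_fin (le_trans L00)// Lmono.
  - by move=> x /=; rewrite /N /= => /negP; rewrite -leNgt => phix; rewrite /f ger0_norm.
(* A zero gradient norm would make every set $\{f > r\}$ with $r > 0$ null by [level_decay], and
   [phi] would vanish almost everywhere. *)
have Alt0 : 0 < A.
  rewrite lt_neqAle A_ge0 andbT; apply/eqP => A_eq0; apply: phi_neq0.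
  have lev0 r : 0 < r -> mu [set x | (r < f x)%R] = 0%E.
    move=> r0; have r20 : 0 < r / 2 by rewrite divr_gt0.
    have levy s : 0 < s -> (mu [set x | (s < f x)%R] < +oo)%E.
      move=> s_gt0; apply: (@le_lt_trans _ _ (K / L s)%:E); last by rewrite ltry.
      exact: (superlevel_le hLpos L00 Lmono).
    have rr : r / 2 < r by lra.
    have := decay _ _ hn rr (levy _ r20).
    rewrite -A_eq0 expr0n/= mulr0 !mul0r => lev.
    rewrite -[LHS]fineK ?ge0_fin_numE ?levy//; congr EFin.
    by apply/eqP; rewrite eq_le lev fine_ge0.
  have : mu.-negligible (\bigcup_k [set x | (k.+1%:R^-1 < f x)%R]).
    apply: negligible_bigcup => k; apply/negligibleP.
      exact: (measurable_superlevel _ mf).2.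
    by apply: lev0; rewrite invr_gt0.
  apply: negligibleS => x /= phix0.
  have fx : 0 < f x by rewrite normr_gt0; apply/eqP.
  exists (Num.truncn (f x)^-1) => //=.
  by rewrite invf_plt ?posrE// truncnS_gt.
have := HC f A mf mLf f_ge0 Alt0 HKf (fun s r => decay s r hn).
set X := C * _ => HX.
have X0 : 0 <= X by rewrite mulr_ge0 ?(ltW C0)// mulr_ge0 ?powR_ge0.
rewrite unlock /Lnorm.
rewrite (_ : \int[_]_x _ = \int[mu]_x (f x `^ q)%:E)%E; last first.
  exact: eq_integral.
apply: (@le_trans _ _ (X%:E `^ q^-1)%E).
  apply: gt0_ler_poweR => //; rewrite ?in_itv/= ?leey ?andbT ?lee_fin ?invr_ge0 ?(ltW q0)//.
  by apply: integral_ge0 => x _; rewrite lee_fin powR_ge0.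
(* Taking the root of order [q] turns the exponent $-q(1/q-\beta)$ of [L] into $-(1/q-\beta)$ and
   $A^q$ into $A$. *)
rewrite poweR_EFin lee_fin /X powRM ?(ltW C0) ?mulr_ge0 ?powR_ge0//.
rewrite powRM ?powR_ge0// -!powRrM mulfV ?gt_eqF// powRr1 ?(ltW Alt0)//.
rewrite mulNr mulrAC mulfV ?gt_eqF// mul1r mulrA.
Unshelve. all: by end_near. Qed.
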